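(* Let $0<\eta<T$, $0<\alpha<\frac{2T}{\eta^2}$ and $0\le\beta<\frac{2T-\alpha\eta^2}{\alpha\eta^2-2\eta+2T}$ be real constants. Let $f\in C([0,\infty),[0,\infty))$, and let $a\in C([0,T],[0,\infty))$ be such that there exists $t_0\in[\eta,T]$ with $a(t_0)>0$. Let $\gamma$, $\Lambda_1$ and $\Lambda_2$ be the constants defined in the context, and let $\theta_1\in(0,1]$. Assume that (i) there exist constants $\rho_2>0$ and $M_2\in[\Lambda_2,\infty)$ such that $f(u)\ge M_2\rho_2$ for all $u\in[\gamma\rho_2,\rho_2]$; (ii) the limit $\lim_{u\to0^+}\frac{f(u)}{u}=\alpha_1$ exists with $\alpha_1\in[0,\theta_1\Lambda_1)$; (iii) the limit $\lim_{u\to\infty}\frac{f(u)}{u}=\beta_2$ exists with $\beta_2\in[0,\theta_1\Lambda_1)$. Then the boundary value problem $$u''(t)+a(t)f(u(t))=0,\quad 0<t<T,\qquad u(0)=\beta u(\eta),\quad u(T)=\alpha\int_0^\eta u(s)\,ds,$$ has at least two positive solutions $u_1$ and $u_2$ such that $0<\|u_1\|<\rho_2<\|u_2\|$.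
   Context: $\|u\|=\max_{t\in[0,T]}|u(t)|$ is the sup norm on $C([0,T],\mathbb{R})$. A positive solution of the boundary value problem is a function $u\in C([0,T])$, twice continuously differentiable on $(0,T)$, satisfying the differential equation on $(0,T)$ and both boundary conditions, with $u(t)\ge0$ on $[0,T]$ and $u(t)>0$ for $t\in(0,T)$. Define $$\gamma=\min\left\{\frac{\eta}{T},\ \frac{\alpha(\beta+1)\eta^2}{2T},\ \frac{\alpha(\beta+1)\eta(T-\eta)}{2T-\alpha(\beta+1)\eta^2}\right\}\in(0,1),$$ $$\Lambda_1=\frac{(2T-\alpha\eta^2)-\beta(\alpha\eta^2-2\eta+2T)}{\left[2(\beta+1)+T^{-1}\beta\eta(\alpha\eta+2)+\alpha\beta T\right]\int_0^T T(T-s)a(s)\,ds},$$ $$\Lambda_2=\frac{(2T-\alpha\eta^2)-\beta(\alpha\eta^2-2\eta+2T)}{2\gamma\eta\int_\eta^T(T-s)a(s)\,ds}.$$ *)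

(* Defs.v *)
From Stdlib Require Import Reals.
From Coquelicot Require Import Coquelicot.
Open Scope R_scope.

(* A function on an interval is represented by a total function R -> R, of which
   only the values on that interval are constrained; [continuous_on] uses the
   relative topology, so continuity is one-sided at the end points. *)
Definition C_seg (T : R) (u : R -> R) : Prop :=
  continuous_on (fun t => 0 <= t <= T) u.

(* [Lub_Rbar] is valued in the extended reals; for u continuous on [0,T] with
   0 <= T the set is nonempty and bounded, and its supremum is the maximum. *)
Definition sup_norm (T : R) (u : R -> R) : R :=
  real (Lub_Rbar (fun y => exists t, 0 <= t <= T /\ y = Rabs (u t))).

(* [Derive] is total (a junk value where the derivative does not exist), hence
   the explicit existence clauses. *)
Definition C2_open (T : R) (u : R -> R) : Prop :=
  forall t, 0 < t < T ->
    ex_derive u t /\ ex_derive (Derive u) t /\ continuous (Derive_n u 2) t.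

Definition bvp_solution (T eta alpha beta : R) (a f u : R -> R) : Prop :=
  C_seg T u /\ C2_open T u /\
  (forall t, 0 < t < T -> Derive_n u 2 t + a t * f (u t) = 0) /\
  u 0 = beta * u eta /\
  u T = alpha * RInt u 0 eta.

Definition positive_solution (T eta alpha beta : R) (a f u : R -> R) : Prop :=
  bvp_solution T eta alpha beta a f u /\
  (forall t, 0 <= t <= T -> 0 <= u t) /\
  (forall t, 0 < t < T -> 0 < u t).

Definition gamma (T eta alpha beta : R) : R :=
  Rmin (eta / T)
    (Rmin (alpha * (beta + 1) * eta ^ 2 / (2 * T))
          (alpha * (beta + 1) * eta * (T - eta)
             / (2 * T - alpha * (beta + 1) * eta ^ 2))).

Definition Lambda1 (T eta alpha beta : R) (a : R -> R) : R :=
  ((2 * T - alpha * eta ^ 2) - beta * (alpha * eta ^ 2 - 2 * eta + 2 * T))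
  / ((2 * (beta + 1) + / T * beta * eta * (alpha * eta + 2) + alpha * beta * T)
       * RInt (fun s => T * (T - s) * a s) 0 T).

Definition Lambda2 (T eta alpha beta : R) (a : R -> R) : R :=
  ((2 * T - alpha * eta ^ 2) - beta * (alpha * eta ^ 2 - 2 * eta + 2 * T))
  / (2 * gamma T eta alpha beta * eta * RInt (fun s => (T - s) * a s) eta T).

(* Main.v *)
Require Import Defs.
From Stdlib Require Import Reals Lra Lia Psatz Classical FunctionalExtensionality.
From Coquelicot Require Import Coquelicot.
From mathcomp Require all_boot all_fingroup zify boolp classical_sets filter.
Open Scope R_scope.

(* Solutions are the fixed points of [w |-> G (a * f(w))], where [G g] is the solution of
   [u'' = - g] under the boundary conditions; [G g] is concave, hence nonnegative and at least
   [gamma] times its maximum on [[eta, T]]. Hypothesis (i) excludes fixed points of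
   [w |-> G (a * (f(w) + c))], [c >= 0], of maximum [<= rho2] unless [c] is small and the
   maximum clearly below [rho2]: [Lambda2] leaves a factor [1 / gamma] of room. Hypotheses (ii)
   and (iii) make [w |-> G (a * f(w))] contract the maximum at some [r1 < rho2] and at some
   [b > rho2].
   For [u2], Schauder's theorem is applied on [[0, b]] with a term [c = k * (rho2 - max w)^+];
   for [u1], where the map expands at the outer radius, first rescale radially so that
   [r1] and [rho2] are exchanged. Schauder's theorem, for equi-Lipschitz functions, is obtained
   from Kuhn's cubical Sperner lemma and compactness along a free ultrafilter. *)

(** * Kuhn's lemma *)

(** The finite limit of [f u / u] at 0 forces [f 0 = 0], so the zero function is itself a fixed
    point and a bare use of Schauder's theorem yields nothing. The constant [c] is there to drive
    away fixed points of low maximum, and it must vanish where the fixed point is finally located,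
    so that the original equation is solved. Being continuous in the maximum, [c] is small close to
    the threshold; there non-existence has to come from hypothesis (i) alone, with a margin. The
    margin exists because [Lambda2] has [gamma] in its denominator, whereas the lower estimate of
    [G g] at [eta] integrates [g] directly and does not lose that factor. Both [c] and the rescaling
    depend on the maximum of the unknown, which is why the nonlinearity given to Schauder's theorem
    takes the maximum as a separate argument. Truncating at the upper radius makes the map a
    self-map at no cost; the truncation is shown to be inactive afterwards. *)

Module Kuhn.
Import all_boot all_fingroup zify.
Local Open Scope nat_scope.
Set Implicit Arguments. Unset Strict Implicit. Unset Printing Implicit Defensive.

(** Parity tool for both halves of Sperner's count: [pivot] fixes exactly one door, and [partner]
    would fix none if no simplex were full. *)
Lemma odd_card_involution (T : finType) (f : T -> T) (D : {set T}) :
  {in D, forall x, f x \in D} -> {in D, forall x, f (f x) = x} ->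
  odd #|D| = odd #|[set x in D | f x == x]|.
Proof.
have [m] := ubnP #|D|; elim: m D => // m IH D leDm fD ffD.
case: (boolP [exists x in D, f x != x]) => [/exists_inP[x Dx fx]|]; last first.
  rewrite negb_exists => /forallP H; congr (odd #|pred_of_set _|).
  by apply/setP => x; rewrite inE; case: (boolP (x \in D)) (H x) => //= _; rewrite negbK => ->.
pose E := D :\ x :\ f x.
have cardE : #|D| = #|E|.+2.
  by rewrite (cardsD1 x D) Dx (cardsD1 (f x) (D :\ x)) !inE fx fD.
have -> : [set y in D | f y == y] = [set y in E | f y == y].
  apply/setP => y; rewrite !inE.
  have [->|ny] := eqVneq y x; first by rewrite (negbTE fx) !andbF.
  have [->|//] := eqVneq y (f x); rewrite ffD // (eq_sym x) (negbTE fx) !andbF //.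
rewrite cardE /= negbK; apply: IH; first by rewrite cardE in leDm; lia.
  move=> y; rewrite !inE => /and3P[n1 n2 Dy]; rewrite fD // andbT.
  apply/andP; split; apply: contraNneq n2 => e; last by rewrite -(ffD y Dy) e eqxx in n1.
  by rewrite -(ffD y Dy) e ffD.
by move=> y; rewrite !inE => /and3P[n1 n2 Dy]; apply: ffD.
Qed.

(** * Sperner's count in the triangulated cube *)

Section Cells.
Variables (N P : nat) (l : {ffun 'I_N.+1 -> nat} -> nat -> bool).
Local Notation n := N.+1.
Let base := {ffun 'I_n -> 'I_P.+1}.
Hypothesis l0 : forall (x : {ffun 'I_n -> nat}) (j : 'I_n), x j = 0 -> l x j = false.
Hypothesis lP : forall (x : {ffun 'I_n -> nat}) (j : 'I_n), x j = P.+1 -> l x j = true.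
Hypothesis lbot : forall x : {ffun 'I_n -> nat}, x ord_max = 0 ->
  forall j : 'I_n, j < N -> l x j = (0 < x j).

(* The prescribed values of [l] on the bottom layer make the standard simplex at the
   origin its only door, so that Sperner's count needs no induction on the dimension. *)
Definition lab (x : {ffun 'I_n -> nat}) := find (fun i => ~~ l x i) (iota 0 n).

Lemma lab_le x : lab x <= n.
Proof. by rewrite /lab -[X in _ <= X](size_iota 0 n) find_size. Qed.

Lemma lab_before x i : i < lab x -> l x i.
Proof.
move=> h; have := before_find 0 h; rewrite nth_iota ?add0n => [/negbFE//|].
exact: leq_trans h (lab_le x).
Qed.

Lemma lab_at x : lab x < n -> l x (lab x) = false.
Proof.
move=> h; have := @nth_find _ 0 (fun i => ~~ l x i) (iota 0 n).
by rewrite has_find size_iota -/(lab x) h nth_iota // add0n => /(_ isT)/negbTE.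
Qed.

(* [(q, s)] encodes the simplex with vertices [q + sum of the e_j with s j < k], [k = 0..n];
   a door is such a simplex with a facet (named by the opposite vertex) carrying all labels [< n]. *)
Definition vert (q : base) (s : 'S_n) (k : nat) : {ffun 'I_n -> nat} :=
  [ffun j => q j + (s j < k)].

Definition vlab q s k := lab (vert q s k).

Definition full q s := forall a, a <= n -> exists2 m, m <= n & vlab q s m = a.

Definition door (c : base * 'S_n * 'I_n.+1) : bool :=
  [forall a : 'I_n, exists m : 'I_n.+1, (m != c.2) && (vlab c.1.1 c.1.2 m == a)].

Lemma doorP (q : base) (s : 'S_n) (k : 'I_n.+1) : reflect
  (forall a, a < n -> exists m, [/\ m <= n, m <> k & vlab q s m = a])
  (door (q, s, k)).
Proof.
apply: (iffP forallP) => [H a an|H a].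
  have /existsP[m /andP[/= mk /eqP e]] := H (Ordinal an).
  exists m; split=> //; first by rewrite -ltnS.
  by move=> e'; move/negP: mk; apply; apply/eqP/val_inj.
have [m [mn mk e]] := H a (ltn_ord a).
apply/existsP; exists (Ordinal (mn : m < n.+1)); rewrite /= e eqxx andbT.
by apply: contra_notN mk => /eqP <-.
Qed.

Definition addq (d : nat -> nat) (q : base) (j0 : 'I_n) : base :=
  [ffun j => if j == j0 then inord (d (q j)) else q j].

Definition upS (s : 'S_n) : 'S_n := (s * perm (can_inj (@ordSK n)))%g.
Definition downS (s : 'S_n) : 'S_n := (s * perm (can_inj (@ord_predK n)))%g.

Lemma upSE s j : upS s j = ordS (s j). Proof. by rewrite permM permE. Qed.
Lemma downSE s j : downS s j = ord_pred (s j). Proof. by rewrite permM permE. Qed.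
Lemma upSK : cancel upS downS.
Proof. by move=> s; apply/permP => j; rewrite downSE upSE ordSK. Qed.
Lemma downSK : cancel downS upS.
Proof. by move=> s; apply/permP => j; rewrite upSE downSE ord_predK. Qed.

Definition swapS (s : 'S_n) (k : nat) : 'S_n := (s * tperm (inord k.-1) (inord k))%g.

(* [pivot] crosses a door to the other simplex sharing that facet; [partner], below, goes
   to the other door of the same simplex. *)
Definition pivot (c : base * 'S_n * 'I_n.+1) : base * 'S_n * 'I_n.+1 :=
  let: (q, s, k) := c in
  if k == 0 :> nat then (addq S q ((s^-1)%g ord0), downS s, ord_max)
  else if k == n :> nat then
    let j := (s^-1)%g ord_max in
    if q j == 0 :> nat then c else (addq predn q j, upS s, ord0)
  else (q, swapS s k, k).

Lemma val_ordS (i : 'I_n) : ordS i = (if i == N :> nat then 0 else i.+1) :> nat.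
Proof.
rewrite /=; case: eqP => [->|e]; first by rewrite modnn.
by rewrite modn_small //; have := ltn_ord i; lia.
Qed.

Lemma val_ord_pred (i : 'I_n) : ord_pred i = (if i == 0 :> nat then N else i.-1) :> nat.
Proof.
rewrite /=; case: eqP => [->|e]; first by rewrite add0n modn_small.
have := ltn_ord i; move=> h.
have -> : (i + N.+1).-1 = i.-1 + N.+1 by lia.
by rewrite modnDr modn_small //; lia.
Qed.

Lemma vert_up (q : base) (s : 'S_n) m : m < n -> q ((s^-1)%g ord0) < P ->
  vert (addq S q ((s^-1)%g ord0)) (downS s) m = vert q s m.+1.
Proof.
move=> mn qP; apply/ffunP => j; rewrite !ffunE downSE val_ord_pred.
have [->|nj] := eqVneq j.
  by rewrite permKV inordK /=; lia.
have : s j != 0 :> nat.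
  apply: contra_neqN nj => /eqP h; rewrite -(permK s j); congr (_ _).
  exact: val_inj.
by move=> h; rewrite (negbTE h); congr (_ + _); move: h; case: (nat_of_ord (s j)).
Qed.

Lemma vert_down (q : base) (s : 'S_n) m : m < n -> q ((s^-1)%g ord_max) != 0 :> nat ->
  vert (addq predn q ((s^-1)%g ord_max)) (upS s) m.+1 = vert q s m.
Proof.
move=> mn q0; apply/ffunP => j; rewrite !ffunE upSE val_ordS.
have [->|nj] := eqVneq j.
  by rewrite permKV eqxx inordK /=; have := ltn_ord (q ((s^-1)%g ord_max)); lia.
have : s j != N :> nat.
  apply: contra_neqN nj => /eqP h; rewrite -(permK s j); congr (_ _).
  exact: val_inj.
by move=> h; rewrite (negbTE h).
Qed.

Lemma val_swapS (s : 'S_n) k j : 0 < k < n ->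
  swapS s k j = (if s j == k.-1 :> nat then k else if s j == k :> nat then k.-1 else s j) :> nat.
Proof.
move=> /andP[k0 kn]; rewrite permM.
have k1 : k.-1 < N.+1 by move: kn; lia.
case: tpermP => [->|->|n1 n2].
- by rewrite !inordK // eqxx.
- by rewrite !inordK // eqxx; case: eqP => //; lia.
case: eqP => [e|_]; first by case: n1; apply: val_inj; rewrite /= inordK.
by case: eqP => // e; case: n2; apply: val_inj; rewrite /= inordK.
Qed.

Lemma vert_swap q s k m : 0 < k < n -> m <> k -> vert q (swapS s k) m = vert q s m.
Proof.
move=> hk mk; apply/ffunP => j; rewrite !ffunE val_swapS //; congr (_ + nat_of_bool _).
by case: eqP => [->|_]; [|case: eqP => [->|_] //]; apply/idP/idP; lia.
Qed.

(* On a door, every label below [n] occurs; so no coordinate can be constantly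
   [P.+1], and only the last one can be constantly [0]. *)
Lemma door_up_lt (q : base) (s : 'S_n) (k : 'I_n.+1) : door (q, s, k) -> k = 0 :> nat -> q ((s^-1)%g ord0) < P.
Proof.
move=> /doorP H k0; set j := (s^-1)%g ord0.
have : q j <= P by rewrite -ltnS.
rewrite leq_eqVlt => /orP[/eqP qP|//].
have [m [mn mk e]] := H j (ltn_ord j).
have lj : l (vert q s m) j = true.
  by apply: lP; rewrite ffunE /j permKV -/j qP -[X in _ = X]addn1; congr (_ + _);
     rewrite /= lt0n; case: eqP mk => // ->; rewrite k0.
by have := lab_at (x := vert q s m); rewrite -/(vlab q s m) e ltn_ord lj => /(_ isT).
Qed.

(** On the layer where the last coordinate is 0 the labels are explicit: label [i'] forces the
    coordinates before [i'] to be positive and coordinate [i'] to be 0. Comparing the vertices with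
    labels [i < i'] gives [q i = 0] and [s i < s i'], and an increasing permutation is the
    identity. *)
Lemma bottom_door (q : base) (s : 'S_n) (k : 'I_n.+1) : door (q, s, k) -> k = n :> nat ->
  q ((s^-1)%g ord_max) = 0 :> nat ->
  [/\ q = [ffun=> ord0], s = 1%g & k = ord_max].
Proof.
move=> /doorP H kn q0; set j := (s^-1)%g ord_max in q0.
have vj m : m < n -> vert q s m j = 0.
  by move=> mn; rewrite ffunE q0 /j permKV ltnNge; move: mn; rewrite ltnS => ->.
have mlt m : m <= n -> m <> k -> m < n by rewrite kn => *; lia.
have jN : j = ord_max.
  apply: val_inj => /=; have [m [mn /(mlt _ mn) mk e]] := H N (ltnSn N).
  have := ltn_ord j; rewrite ltnS leq_eqVlt => /orP[/eqP//|jN].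
  by have := @lab_before (vert q s m) j; rewrite -/(vlab q s m) e jN (l0 (vj _ mk)) => /(_ isT).
have sx m i : m < n -> i < N -> l (vert q s m) i = (0 < vert q s m (inord i)).
  move=> mn iN; have iK : @inord N i = i :> nat by rewrite inordK // ltnS ltnW.
  by rewrite -[in LHS]iK lbot ?iK // -jN; apply: vj.
have key (i i' : 'I_n) : i < i' -> (q i = 0 :> nat) /\ s i < s i'.
  move=> ii'; have iN : i < N by have := ltn_ord i'; lia.
  have [m [mn /(mlt _ mn) mk e]] := H i' (ltn_ord i').
  have [m2 [mn2 /(mlt _ mn2) mk2 e2]] := H i (ltn_ord i).
  have A : 0 < vert q s m i.
    by have := @lab_before (vert q s m) i; rewrite -/(vlab q s m) e sx // inord_val => /(_ ii').
  have B : vert q s m2 i = 0.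
    have := @lab_at (vert q s m2); rewrite -/(vlab q s m2) e2 ltn_ord sx // inord_val.
    by case: (vert _ _ _ _) => // ? /(_ isT).
  have C : vert q s m i' = 0.
    have := ltn_ord i'; rewrite ltnS leq_eqVlt => /orP[/eqP i'N|i'N].
      by rewrite -(vj m mk) jN; congr (vert _ _ _ _); apply: val_inj.
    have := @lab_at (vert q s m); rewrite -/(vlab q s m) e ltn_ord sx // inord_val.
    by case: (vert _ _ _ _) => // ? /(_ isT).
  move: A B C; rewrite !ffunE => A B C; split; first by move/eqP: B; rewrite addn_eq0 => /andP[/eqP].
  move/eqP: B; rewrite addn_eq0 => /andP[/eqP qi _]; move: A; rewrite qi add0n lt0b => A.
  by move/eqP: C; rewrite addn_eq0 eqb0 -leqNgt => /andP[_]; apply: leq_trans.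
have qz : q = [ffun=> ord0].
  apply/ffunP => i; rewrite ffunE; apply: val_inj => /=.
  have := ltn_ord i; rewrite ltnS leq_eqVlt => /orP[/eqP iN|iN].
    by rewrite -[RHS]q0 jN; congr (nat_of_ord (q _)); apply: val_inj.
  by have [] := key i ord_max iN.
have ge i : forall h : i < n, i <= s (Ordinal h).
  elim: i => // i IH h; have h' : i < n by lia.
  by have [_] := key (Ordinal h') (Ordinal h) (ltnSn i); apply: leq_ltn_trans; apply: IH.
have le d : forall (i : 'I_n), d + i = N -> s i <= i.
  elim: d => [|d IH] i; first by rewrite add0n => ->; rewrite -ltnS ltn_ord.
  move=> e; have h : i.+1 < n by lia.
  have [_ h2] := key i (Ordinal h) (ltnSn i).
  by have := IH (Ordinal h); rewrite /= in h2 *; lia.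
split=> //; last by apply: val_inj; rewrite /= kn.
apply/permP => i; rewrite perm1; apply: val_inj; apply/eqP; rewrite eqn_leq.
have -> : i = Ordinal (ltn_ord i) by apply: val_inj.
rewrite ge andbT; apply: (le (N - i)) => /=; have := ltn_ord i; lia.
Qed.

Lemma bottom_is_door : door ([ffun=> ord0], 1%g, ord_max).
Proof.
apply/doorP => a an; exists a; split; [by rewrite ltnW| by move=> e; rewrite e ltnn in an|].
pose x := vert [ffun=> ord0] 1%g a; change (lab x = a).
have xE (j : 'I_n) : x j = (j < a) by rewrite !ffunE perm1.
have x0 : x ord_max = 0 by rewrite xE ltnNge -ltnS an.
have lx (j : 'I_n) : l x j = (j < a).
  have := ltn_ord j; rewrite ltnS leq_eqVlt => /orP[/eqP jN|jN].
    have -> : j = ord_max by apply: val_inj.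
    by rewrite l0 // ltnNge -ltnS an.
  by rewrite lbot // xE lt0b.
have [la|la|//] := ltngtP (lab x) a.
- have ln := ltn_trans la an.
  by have := lab_at ln; rewrite (lx (Ordinal ln)) /= la.
- by have := lab_before la; rewrite (lx (Ordinal an)) /= ltnn.
Qed.

Lemma pivot_door c : door c -> door (pivot c).
Proof.
case: c => [[q s] k] D; rewrite /pivot; have /doorP H := D.
case: eqP => [k0|k0].
  have qP := door_up_lt D k0; apply/doorP => a an.
  have [m [mn mk e]] := H a an; exists m.-1.
  have m0 : 0 < m by rewrite lt0n; apply/eqP => m0; apply: mk; rewrite m0 k0.
  have mn' : m.-1 < n by move: mn; lia.
  split; [lia|by move=> e'; move: mn'; rewrite e' ltnn|].
  by rewrite /vlab vert_up // prednK.
case: eqP => [kn|kn].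
  case: eqP => [//|/eqP q0]; apply/doorP => a an.
  have [m [mn mk e]] := H a an; exists m.+1.
  have mn' : m < n by rewrite ltn_neqAle mn andbT; apply/eqP => m0; apply: mk; rewrite m0 kn.
  by split=> //; rewrite /vlab vert_down.
have hk : 0 < k < n by have := ltn_ord k; lia.
apply/doorP => a an; have [m [mn mk e]] := H a an; exists m; split=> //.
by rewrite /vlab vert_swap.
Qed.

Lemma swapSK s k : swapS (swapS s k) k = s.
Proof. by rewrite /swapS -mulgA tperm2 mulg1. Qed.

Lemma pivotK c : door c -> pivot (pivot c) = c.
Proof.
case: c => [[q s] k] D; rewrite {2}/pivot.
case: eqP => [k0|k0].
  have qP := door_up_lt D k0.
  rewrite /pivot /= eqxx.
  have -> : (((downS s)^-1)%g ord_max) = (s^-1)%g ord0.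
    apply: (@perm_inj _ (downS s)); rewrite permKV downSE permKV.
    by apply: val_inj; rewrite [RHS]val_ord_pred.
  rewrite ffunE eqxx inordK ?ltnS //= downSK; congr (_, _, _); last exact: val_inj.
  apply/ffunP => j; rewrite !ffunE; case: eqP => [->|//].
  by rewrite inordK ?ltnS //= inord_val.
case: eqP => [kn|kn].
  case: eqP => q0; rewrite /pivot.
    by case: eqP => //; case: eqP => //; case: eqP.
  rewrite eqxx.
  have -> : (((upS s)^-1)%g ord0) = (s^-1)%g ord_max.
    apply: (@perm_inj _ (upS s)); rewrite permKV upSE permKV.
    by apply: val_inj; rewrite [RHS]val_ordS /= eqxx.
  rewrite upSK; congr (_, _, _); last exact: val_inj.
  apply/ffunP => j; rewrite !ffunE; case: eqP => [->|//].
  have := ltn_ord (q ((s^-1)%g ord_max)) => h.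
  rewrite inordK; last lia.
  by rewrite prednK ?inord_val // lt0n; apply/eqP.
by rewrite /pivot; case: eqP => // _; case: eqP => // _; rewrite swapSK.
Qed.

Lemma pivot_fixed c : door c -> (pivot c == c) = (c == ([ffun=> ord0], 1%g, ord_max)).
Proof.
case: c => [[q s] k] D; apply/eqP/eqP; last first.
  by case=> -> -> ->; rewrite /pivot /= eqxx ffunE.
rewrite /pivot; case: eqP => [k0|k0].
  by case=> _ _ /(congr1 (@nat_of_ord _)) /=; rewrite k0.
case: eqP => [kn|kn].
  case: eqP => [q0 _|q0]; first by have [-> -> ->] := bottom_door D kn q0.
  by case=> _ _ /(congr1 (@nat_of_ord _)) /=; rewrite kn.
have hk : 0 < k < n by have := ltn_ord k; lia.
case=> /permP/(_ ((s^-1)%g (inord k))) /(congr1 (@nat_of_ord _)).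
rewrite val_swapS // permKV inordK; last by case/andP: hk.
by rewrite eqxx; case: eqP; lia.
Qed.

Lemma odd_doors : odd #|[set c | door c]|.
Proof.
rewrite (@odd_card_involution _ pivot); first last.
- by move=> c; rewrite inE => /pivotK.
- by move=> c; rewrite !inE => /pivot_door.
have -> : [set x in [set c | door c] | pivot x == x] = [set ([ffun=> ord0], 1%g, ord_max)].
  apply/setP => c; rewrite !inE; case: (boolP (door c)) => /= [/pivot_fixed//|D].
  by apply/esym; apply: contraNF D => /eqP ->; apply: bottom_is_door.
by rewrite cards1.
Qed.

Definition partner (c : base * 'S_n * 'I_n.+1) : base * 'S_n * 'I_n.+1 :=
  let: (q, s, k) := c in
  (q, s, odflt k [pick m : 'I_n.+1 | (m != k) && (vlab q s m == vlab q s k)]).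

(** Pigeonhole: the [n] vertices other than [k] carry the [n] labels below [n], hence each exactly
    once. As the simplex is not full, the label of [k] is below [n] too, so exactly one other vertex
    shares it. *)
Lemma not_full_partner (q : base) (s : 'S_n) (k : 'I_n.+1) : ~ full q s -> door (q, s, k) ->
  exists m : 'I_n.+1, [/\ m != k, vlab q s m = vlab q s k &
    forall m' : 'I_n.+1, m' != k -> vlab q s m' = vlab q s k -> m' = m].
Proof.
move=> nf D; have /doorP H := D.
have kn : vlab q s k < n.
  have := lab_le (vert q s k); rewrite leq_eqVlt -/(vlab q s k) => /orP[/eqP e|//].
  case: nf => a; rewrite leq_eqVlt => /orP[/eqP ->|/H[m [mn _ <-]]]; last by exists m.
  by exists k; rewrite -1?ltnS.
pose f (m : 'I_n.+1) : 'I_n.+1 := inord (vlab q s m).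
have fE m : f m = vlab q s m :> nat by rewrite inordK // ltnS lab_le.
have inj : {in [set~ k] &, injective f}.
  apply/imset_injP; rewrite eqn_leq leq_imset_card /=.
  have -> : #|[set~ k]| = #|[set~ (ord_max : 'I_n.+1)]| by rewrite !cardsC1.
  apply: subset_leq_card; apply/subsetP => a; rewrite !inE => na.
  have an : a < n.
    have := ltn_ord a; rewrite ltnS leq_eqVlt => /orP[/eqP e|//].
    by case/eqP: na; apply: val_inj.
  have [m [mn mk e]] := H a an; apply/imsetP; exists (Ordinal (mn : m < n.+1)).
    by rewrite !inE; apply/eqP => e'; apply: mk; rewrite -e'.
  by apply: val_inj; rewrite /= fE.
have [m [mn mk e]] := H _ kn; exists (Ordinal (mn : m < n.+1)).
have mk' : Ordinal (mn : m < n.+1) != k by apply/eqP => e'; apply: mk; rewrite -e'.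
split=> // m' m'k e'; apply: inj; rewrite ?inE //.
by apply: val_inj; rewrite /= !fE e' /= e.
Qed.

Lemma partner_door c : ~ full c.1.1 c.1.2 -> door c -> door (partner c).
Proof.
case: c => [[q s] k] /= nf D; have [m [mk e _]] := not_full_partner nf D.
case: pickP => [m' /andP[/eqP m'k /eqP e'] /=|/(_ m)]; last by rewrite mk e eqxx.
have /doorP H := D; apply/doorP => a an; have [m2 [m2n m2k e2]] := H a an.
have [m2m'|m2m'] := eqVneq m2 m'; last by exists m2; split=> //; apply/eqP.
exists k; split; [by rewrite -ltnS| by move=> km; apply: m'k; apply: val_inj|].
by rewrite -e' -m2m'.
Qed.

Lemma partnerK c : ~ full c.1.1 c.1.2 -> door c -> partner (partner c) = c.
Proof.
move=> nf D; have := partner_door nf D.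
case: c nf D => [[q s] k] /= nf D; have [m [mk e u]] := not_full_partner nf D.
case: pickP => [m' /andP[/eqP m'k /eqP e'] /= D'|/(_ m)]; last by rewrite mk e eqxx.
have [m2 [m2m' e2 u2]] := not_full_partner nf D'.
case: pickP => [m3 /andP[m3m' /eqP e3] /=|/(_ m2)]; last by rewrite m2m' e2 eqxx.
congr (_, _, _); rewrite (u2 m3) //; apply/esym/u2 => //.
by apply/eqP => km; apply: m'k.
Qed.

(** The doors are odd in number; without a full simplex [partner] would match them in pairs. *)
Lemma exists_full : exists q s, full q s.
Proof.
pose fullb (c : base * 'S_n) :=
  [forall a : 'I_n.+1, exists m : 'I_n.+1, vlab c.1 c.2 m == a].
have fullP q s : fullb (q, s) -> full q s.
  move=> /forallP H a an; have /existsP[m /eqP e] := H (Ordinal (an : a < n.+1)).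
  by exists m; rewrite -1?ltnS.
have fullbP q s : full q s -> fullb (q, s).
  move=> H; apply/forallP => a; have := ltn_ord a; rewrite ltnS => /H[m mn e].
  by apply/existsP; exists (Ordinal (mn : m < n.+1)); rewrite e.
case: (boolP [exists c, fullb c]) => [/existsP[[q s] /fullP h]|]; first by exists q, s.
rewrite negb_exists => /forallP nf.
have nfull q s : ~ full q s by move=> /fullbP h; have := nf (q, s); rewrite h.
have := odd_doors; rewrite (@odd_card_involution _ partner); first last.
- by move=> c; rewrite inE => /partnerK ->.
- by move=> c; rewrite !inE => /partner_door; apply.
suff -> : [set x in [set c | door c] | partner x == x] = set0 by rewrite cards0.
apply/setP => -[[q s] k]; rewrite !inE; apply/negbTE/negP => /andP[D /eqP].
have [m [mk e u]] := not_full_partner (nfull q s) D.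
case=> h; case: pickP h => [m' /andP[/eqP m'k _] //|/(_ m)].
by rewrite mk e eqxx.
Qed.
End Cells.

(** In a full simplex the vertex labelled [n] has all components of [lam] true, and the vertex
    labelled [i] has component [i] false; both lie in one cell. *)
Lemma kuhn n p (lam : (nat -> nat) -> nat -> bool) :
  (forall x i, i < n -> x i = 0 -> lam x i = false) ->
  (forall x i, i < n -> x i = p -> lam x i = true) ->
  exists q : nat -> nat, forall i, i < n -> exists y z : nat -> nat,
    [/\ lam y i = false, lam z i = true,
        forall j, j < n -> q j <= y j <= (q j).+1 /\ y j <= p &
        forall j, j < n -> q j <= z j <= (q j).+1 /\ z j <= p].
Proof.
case: n => [|N] lam0 lamp; first by exists (fun=> 0).
(* An artificial bottom layer with the prescribed labels is glued under the cube. [adj] undoes this: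
   it shifts the last coordinate down by one, and truncates the others at [p], because the enlarged
   cube has side [p.+1] in every direction. *)
pose adj (x : {ffun 'I_N.+1 -> nat}) (j : nat) :=
  if j == N then (x ord_max).-1 else minn (x (inord j)) p.
pose l (x : {ffun 'I_N.+1 -> nat}) (i : nat) :=
  if x ord_max == 0 then (i < N) && (0 < x (inord i)) else lam (adj x) i.
have l0 (x : {ffun 'I_N.+1 -> nat}) (j : 'I_N.+1) : x j = 0 -> l x j = false.
  move=> xj; rewrite /l; case: eqP => [_|xN].
    by rewrite inord_val xj andbF.
  apply: lam0 => //; rewrite /adj inord_val; case: eqP => [jN|_]; last by rewrite xj min0n.
  by case: xN; rewrite -xj; congr (x _); apply: val_inj.
have lP (x : {ffun 'I_N.+1 -> nat}) (j : 'I_N.+1) : x j = p.+1 -> l x j = true.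
  move=> xj; rewrite /l; case: eqP => [xN|xN].
    rewrite inord_val xj andbT; have := ltn_ord j; rewrite ltnS leq_eqVlt => /orP[/eqP jN|//].
    suff : x j = 0 by rewrite xj.
    by rewrite -xN; congr (x _); apply: val_inj.
  apply: lamp => //; rewrite /adj inord_val; case: eqP => [jN|_]; last by rewrite xj; lia.
  have -> : ord_max = j by apply: val_inj.
  by rewrite xj.
have lbot (x : {ffun 'I_N.+1 -> nat}) : x ord_max = 0 -> forall j : 'I_N.+1, j < N -> l x j = (0 < x j).
  by move=> xN j jN; rewrite /l xN eqxx jN inord_val.
have [q [s F]] := exists_full l0 lP lbot.
have [mt mtn et] := F N.+1 (leqnn _).
have top (i : 'I_N.+1) : l (vert q s mt) i = true.
  by apply: lab_before; rewrite -/(vlab l q s mt) et.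
have bot (i : 'I_N.+1) : exists m, l (vert q s m) i = false.
  have [m mn e] := F i (ltnW (ltn_ord i)); exists m.
  have := @lab_at N l (vert q s m); rewrite -/(vlab l q s m) e.
  by apply.
(* The full simplex avoids the artificial layer: the vertex whose components are all true has its
   last coordinate neither 0 (label prescribed false) nor 1 ([adj] is 0 there, so [lam] is
   false). *)
have qN : 0 < q ord_max.
  rewrite lt0n; apply/eqP => qN.
  have := top ord_max; rewrite /l; case: eqP => [_|]; first by rewrite /= ltnn.
  by move=> h; rewrite lam0 // /adj eqxx ffunE qN; case: (_ < _).
pose base (j : nat) := if j == N then (q ord_max).-1 else minn (q (inord j)) p.
have near m j : j < N.+1 -> base j <= adj (vert q s m) j <= (base j).+1 /\ adj (vert q s m) j <= p.
  move=> jn; rewrite /base /adj; case: eqP => [jN|jN]; rewrite ffunE.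
    by move: (ltn_ord (q ord_max)) => hq; case: (s ord_max < m); lia.
  by case: (s (inord j) < m); lia.
have lE m (i : nat) : l (vert q s m) i = lam (adj (vert q s m)) i.
  by rewrite /l ffunE; case: eqP => //; case: (q _ : nat) qN.
exists base => i i_n; have [m e] := bot (Ordinal i_n).
exists (adj (vert q s m)), (adj (vert q s mt)); split; rewrite -?lE //.
- exact: (top (Ordinal i_n)).
- by move=> j; apply: near.
- by move=> j; apply: near.
Qed.

Lemma kuhn_nat n p (lam : (nat -> nat) -> nat -> bool) :
  (forall x i, (i < n)%coq_nat -> x i = 0 -> lam x i = false) ->
  (forall x i, (i < n)%coq_nat -> x i = p -> lam x i = true) ->
  exists q : nat -> nat, forall i, (i < n)%coq_nat -> exists y z : nat -> nat,
    lam y i = false /\ lam z i = true /\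
    forall j, (j < n)%coq_nat ->
      ((q j <= y j)%coq_nat /\ (y j <= S (q j))%coq_nat /\ (y j <= p)%coq_nat) /\
      ((q j <= z j)%coq_nat /\ (z j <= S (q j))%coq_nat /\ (z j <= p)%coq_nat).
Proof.
move=> h0 hp; have [||q H] := @kuhn n p lam.
- by move=> x i /ltP; apply: h0.
- by move=> x i /ltP; apply: hp.
exists q => i /ltP /H[y [z [h1 h2 h3 h4]]]; exists y, z; do 2!split=> //.
by move=> j /ltP jn; have := h3 j jn; have := h4 j jn; lia.
Qed.
End Kuhn.

(** * A free ultrafilter on the natural numbers *)

Module Ultrafilter.
Import all_boot boolp classical_sets filter.
Local Open Scope nat_scope.
Local Open Scope classical_set_scope.

Lemma free_ultrafilter : exists U : (nat -> Prop) -> Prop,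
  (forall N, U (fun n => (N <= n)%coq_nat)) /\
  (forall A B : nat -> Prop, U A -> U B -> U (fun n => A n /\ B n)) /\
  (forall A B : nat -> Prop, (forall n, A n -> B n) -> U A -> U B) /\
  (forall A : nat -> Prop, U A \/ U (fun n => ~ A n)) /\
  (forall A : nat -> Prop, U A -> exists n, A n).
Proof.
have [U [Uu leU]] := @ultraFilterLemma _ (\oo : set_system nat) _.
exists U; split; last split; last split; last split.
- by move=> N; apply: leU; exists N => // n /= /leP.
- by move=> A B UA UB; apply: filterI.
- by move=> A B AB; apply: filterS.
- by move=> A; apply: in_ultra_setVsetC.
- by move=> A /filter_ex.
Qed.
End Ultrafilter.

(** * Fixed points of maps on Lipschitz functions *)

Lemma inv_nat_lt (e : R) : 0 < e -> exists n, (0 < n)%nat /\ / INR n < e.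
Proof.
  intros He. destruct (archimed_cor1 e He) as [n [H1 H2]]. exists n. now split.
Qed.

Definition box (n : nat) (b : R) (x : nat -> R) : Prop :=
  forall i, (i < n)%nat -> 0 <= x i <= b.

(** Approximate Brouwer theorem on a cube: in the cell given by Kuhn's lemma every coordinate of
    [F x - x] takes both weak signs, so uniform continuity makes it small at the corner [q]. *)
Lemma approx_fixed_point (n : nat) (b : R) (F : (nat -> R) -> nat -> R) :
  0 < b ->
  (forall x, box n b x -> box n b (F x)) ->
  (forall eps, 0 < eps -> exists delta, 0 < delta /\ forall x y, box n b x -> box n b y ->
    (forall i, (i < n)%nat -> Rabs (x i - y i) <= delta) ->
    forall i, (i < n)%nat -> Rabs (F x i - F y i) <= eps) ->
  forall eps, 0 < eps ->
  exists x, box n b x /\ forall i, (i < n)%nat -> Rabs (F x i - x i) <= eps.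
Proof.
  intros Hb HF HC eps Heps.
  destruct (HC (eps / 2) ltac:(lra)) as [delta [Hd HFd]].
  assert (Hm : 0 < Rmin delta (eps / 2)) by (apply Rmin_glb_lt; lra).
  destruct (inv_nat_lt (Rmin delta (eps / 2) / b)) as [p [Hp Hpe]].
  { apply Rdiv_lt_0_compat; lra. }
  assert (Hp0 : 0 < INR p) by now apply lt_0_INR.
  set (val := fun k : nat => b * INR k / INR p).
  assert (Hval : forall k, (k <= p)%nat -> 0 <= val k <= b).
  { intros k Hk. unfold val. apply le_INR in Hk. pose proof (pos_INR k). split.
    - apply Rdiv_le_0_compat; nra.
    - apply Rle_div_l; nra. }
  assert (Hstep : b / INR p <= Rmin delta (eps / 2)).
  { apply Rlt_le in Hpe. apply Rmult_le_compat_l with (r := b) in Hpe; [|lra].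
    replace (b * (Rmin delta (eps / 2) / b)) with (Rmin delta (eps / 2)) in Hpe by (field; lra).
    exact Hpe. }
  assert (Hnear : forall k k', (k <= k')%nat -> (k' <= S k)%nat -> Rabs (val k' - val k) <= Rmin delta (eps / 2)).
  { intros k k' H1 H2. apply Rle_trans with (2 := Hstep). unfold val.
    replace (b * INR k' / INR p - b * INR k / INR p) with (b / INR p * (INR k' - INR k)) by (field; lra).
    assert (0 < b / INR p) by (apply Rdiv_lt_0_compat; lra).
    apply le_INR in H1. apply le_INR in H2. rewrite S_INR in H2.
    rewrite Rabs_pos_eq; nra. }
  set (pt := fun (x : nat -> nat) i => val (x i)).
  (* True stands for [F x i <= x i] and false for [F x i >= x i]. The values forced at [p] and 0
     respect this, since [F] maps the box into itself. *)
  set (lam := fun (x : nat -> nat) i =>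
    if Nat.eqb (x i) p then true else if Nat.eqb (x i) 0 then false
    else if Rlt_dec (F (pt x) i) (val (x i)) then true else false).
  destruct (@Kuhn.kuhn_nat n p lam) as [q Hq].
  { intros x i _ Hx. unfold lam. rewrite Hx. destruct p; [lia|]. reflexivity. }
  { intros x i _ Hx. unfold lam. rewrite Hx, Nat.eqb_refl. reflexivity. }
  assert (Hqb : box n b (pt q)).
  { intros i Hi. destruct (Hq i Hi) as (y & z & _ & _ & H). apply Hval. specialize (H i Hi). lia. }
  exists (pt q). split; [exact Hqb|].
  intros i Hi. destruct (Hq i Hi) as (y & z & Hy & Hz & H).
  assert (By : box n b (pt y)) by (intros j Hj; apply Hval; specialize (H j Hj); lia).
  assert (Bz : box n b (pt z)) by (intros j Hj; apply Hval; specialize (H j Hj); lia).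
  assert (Ny : forall j, (j < n)%nat -> Rabs (pt y j - pt q j) <= Rmin delta (eps / 2))
    by (intros j Hj; apply Hnear; specialize (H j Hj); lia).
  assert (Nz : forall j, (j < n)%nat -> Rabs (pt z j - pt q j) <= Rmin delta (eps / 2))
    by (intros j Hj; apply Hnear; specialize (H j Hj); lia).
  pose proof (Rmin_l delta (eps / 2)). pose proof (Rmin_r delta (eps / 2)).
  assert (Fy := HFd _ _ By Hqb (fun j Hj => Rle_trans _ _ _ (Ny j Hj) (Rmin_l _ _)) i Hi).
  assert (Fz := HFd _ _ Bz Hqb (fun j Hj => Rle_trans _ _ _ (Nz j Hj) (Rmin_l _ _)) i Hi).
  specialize (Ny i Hi). specialize (Nz i Hi).
  assert (Ly : val (y i) <= F (pt y) i).
  { unfold lam in Hy. destruct (Nat.eqb (y i) p); [discriminate|].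
    destruct (Nat.eqb_spec (y i) 0) as [E|E].
    - rewrite E. unfold val at 1. simpl INR. pose proof (HF _ By i Hi) as [? _].
      unfold Rdiv. rewrite Rmult_0_r, Rmult_0_l. assumption.
    - destruct (Rlt_dec (F (pt y) i) (val (y i))); [discriminate|lra]. }
  assert (Lz : F (pt z) i <= val (z i)).
  { unfold lam in Hz. destruct (Nat.eqb_spec (z i) p) as [E|E].
    - rewrite E. unfold val. pose proof (HF _ Bz i Hi) as [_ ?].
      replace (b * INR p / INR p) with b by (field; lra). assumption.
    - destruct (Nat.eqb (z i) 0); [discriminate|].
      destruct (Rlt_dec (F (pt z) i) (val (z i))); [lra|discriminate]. }
  change (pt y i) with (val (y i)) in Ny. change (pt z i) with (val (z i)) in Nz.
  change (pt q i) with (val (q i)) in *.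
  apply Rabs_le_between in Fy, Fz, Ny, Nz. apply Rabs_le. lra.
Qed.

(** * Lipschitz functions and their discretisation *)

Definition lip (L b : R) (u : R -> R) : Prop :=
  (forall t, 0 <= u t <= b) /\ forall s t, Rabs (u s - u t) <= L * Rabs (s - t).

(* McShane's Lipschitz extension, cut off at [b], of the values [x k] at the nodes [h * k], [k < n]. *)
Fixpoint mcshane (L b h : R) (x : nat -> R) (n : nat) (t : R) : R :=
  match n with
  | O => b
  | S k => Rmin (mcshane L b h x k t) (x k + L * Rabs (t - h * INR k))
  end.

Lemma Rmin_close (a b c d e : R) :
  Rabs (a - c) <= e -> Rabs (b - d) <= e -> Rabs (Rmin a b - Rmin c d) <= e.
Proof.
  intros H1 H2. apply Rabs_le_between in H1, H2. apply Rabs_le.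
  unfold Rmin; destruct (Rle_dec a b), (Rle_dec c d); lra.
Qed.

Lemma mcshane_ge (L b h : R) (x : nat -> R) (n : nat) (t v : R) :
  v <= b -> (forall i, (i < n)%nat -> v <= x i + L * Rabs (t - h * INR i)) ->
  v <= mcshane L b h x n t.
Proof.
  intros Hb. induction n as [|n IH]; intros H; simpl; [exact Hb|].
  apply Rmin_glb; [apply IH; intros; apply H; lia|apply H; lia].
Qed.

Lemma mcshane_le (L b h : R) (x : nat -> R) (n i : nat) :
  (i < n)%nat -> mcshane L b h x n (h * INR i) <= x i.
Proof.
  induction n as [|n IH]; intros H; [lia|]. simpl.
  destruct (Nat.eq_dec i n) as [->|E].
  - eapply Rle_trans; [apply Rmin_r|].
    replace (h * INR n - h * INR n) with 0 by ring. rewrite Rabs_R0. lra.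
  - eapply Rle_trans; [apply Rmin_l|]. apply IH. lia.
Qed.

Lemma mcshane_lip (L b h : R) (x : nat -> R) (n : nat) :
  0 <= L -> 0 <= b -> box n b x -> lip L b (mcshane L b h x n).
Proof.
  intros HL Hb Hx. split.
  - intros t. split.
    + apply mcshane_ge; [exact Hb|]. intros i Hi. destruct (Hx i Hi).
      pose proof (Rabs_pos (t - h * INR i)). nra.
    + clear Hx. induction n as [|n IH]; simpl; [lra|].
      eapply Rle_trans; [apply Rmin_l|exact IH].
  - intros s t. clear Hx. induction n as [|n IH]; simpl.
    + replace (b - b) with 0 by ring. rewrite Rabs_R0. pose proof (Rabs_pos (s - t)). nra.
    + apply Rmin_close; [exact IH|].
      replace (x n + L * Rabs (s - h * INR n) - (x n + L * Rabs (t - h * INR n)))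
        with (L * (Rabs (s - h * INR n) - Rabs (t - h * INR n))) by ring.
      rewrite Rabs_mult, (Rabs_pos_eq L) by exact HL.
      apply Rmult_le_compat_l; [exact HL|].
      eapply Rle_trans; [apply Rabs_triang_inv2|]. right. f_equal. ring.
Qed.

Lemma mcshane_close (L b h e : R) (x y : nat -> R) (n : nat) (t : R) : 0 <= e ->
  (forall i, (i < n)%nat -> Rabs (x i - y i) <= e) ->
  Rabs (mcshane L b h x n t - mcshane L b h y n t) <= e.
Proof.
  intros He. induction n as [|n IH]; intros H; simpl.
  - replace (b - b) with 0 by ring. now rewrite Rabs_R0.
  - apply Rmin_close; [apply IH; intros; apply H; lia|].
    replace (x n + L * Rabs (t - h * INR n) - (y n + L * Rabs (t - h * INR n))) with (x n - y n) by ring.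
    apply H. lia.
Qed.

Lemma near_node (T : R) (n : nat) (t : R) : 0 < T -> (0 < n)%nat -> 0 <= t <= T ->
  exists i, (i < S n)%nat /\ 0 <= T / INR n * INR i <= T /\ Rabs (t - T / INR n * INR i) <= T / INR n.
Proof.
  intros HT Hn Ht. apply lt_0_INR in Hn. set (h := T / INR n).
  assert (Hh : 0 < h) by (apply Rdiv_lt_0_compat; lra).
  assert (HhT : h * INR n = T) by (unfold h; field; lra).
  destruct (nfloor_ex (t / h)) as [k [H1 H2]]; [apply Rdiv_le_0_compat; lra|].
  assert (E : t = t / h * h) by (field; lra).
  exists k. assert (A : INR k * h <= t) by (rewrite E; apply Rmult_le_compat_r; lra).
  assert (B : t <= (INR k + 1) * h) by (rewrite E; apply Rmult_le_compat_r; lra).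
  pose proof (pos_INR k). split; [|split; [split; nra|apply Rabs_le; nra]].
  apply INR_lt. rewrite S_INR. nra.
Qed.

Section Schauder.
Variables (T L b : R) (Psi : (R -> R) -> R -> R).
Hypotheses (HT : 0 < T) (HL : 0 <= L) (Hb : 0 < b).
Hypothesis Psi_lip : forall u, lip L b u -> lip L b (Psi u).
Hypothesis Psi_cont : forall eps, 0 < eps -> exists delta, 0 < delta /\
  forall u v, lip L b u -> lip L b v ->
  (forall t, 0 <= t <= T -> Rabs (u t - v t) <= delta) ->
  forall t, 0 <= t <= T -> Rabs (Psi u t - Psi v t) <= eps.

(** The values at the nodes form the finite-dimensional unknown. McShane's extension is Lipschitz
    whatever these values are, so the whole box can be used. *)
Lemma approx_fixed_function (eps : R) : 0 < eps ->
  exists u, lip L b u /\ forall t, 0 <= t <= T -> Rabs (Psi u t - u t) <= eps.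
Proof.
  intros Heps.
  (* The mesh gives [L * h <= eps / 4]: between nodes each of the two functions moves by at most
     that, and the error at a node is at most [eps / 2]. [L + 1] covers [L = 0]. *)
  destruct (inv_nat_lt (eps / (4 * T * (L + 1)))) as [n [Hn Hne]].
  { apply Rdiv_lt_0_compat; nra. }
  set (h := T / INR n).
  assert (Hn0 : 0 < INR n) by now apply lt_0_INR.
  assert (Hh : 0 < h) by (apply Rdiv_lt_0_compat; lra).
  assert (HLh : L * h <= eps / 4).
  { apply Rlt_le in Hne. apply Rmult_le_compat_l with (r := T * (L + 1)) in Hne; [|nra].
    replace (T * (L + 1) * (eps / (4 * T * (L + 1)))) with (eps / 4) in Hne by (field; lra).
    replace (T * (L + 1) * / INR n) with (h * (L + 1)) in Hne by (unfold h; field; lra). nra. }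
  set (E := fun x => mcshane L b h x (S n)).
  set (F := fun x i => Psi (E x) (h * INR i)).
  assert (Hnode : forall i, (i < S n)%nat -> 0 <= h * INR i <= T).
  { intros i Hi. pose proof (pos_INR i). assert (INR i <= INR n) by (apply le_INR; lia).
    assert (h * INR n = T) by (unfold h; field; lra). nra. }
  destruct (approx_fixed_point (S n) b F Hb) with (eps := eps / 2) as [x [Bx Hx]]; [| |lra|].
  { intros x Bx i Hi. apply (Psi_lip (E x)). apply mcshane_lip; [lra|lra|exact Bx]. }
  { intros e He. destruct (Psi_cont e He) as [d [Hd H]]. exists d. split; [exact Hd|].
    intros x y Bx By Hxy i Hi. apply H.
    - apply mcshane_lip; [lra|lra|exact Bx].
    - apply mcshane_lip; [lra|lra|exact By].
    - intros t _. apply mcshane_close; [lra|exact Hxy].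
    - now apply Hnode. }
  assert (LE : lip L b (E x)) by (apply mcshane_lip; [lra|lra|exact Bx]).
  exists (E x). split; [exact LE|]. intros t Ht.
  destruct (near_node T n t HT Hn Ht) as [i [Hi [_ Hti]]]. fold h in Hti.
  pose proof (Psi_lip _ LE) as [LPb LPl]. destruct LE as [LEb LEl].
  assert (U1 : E x (h * INR i) <= x i) by now apply mcshane_le.
  (* The data [x] need not be Lipschitz, so the extension may fall below [x i] at node [i]. It falls
     little: [x] is within [eps / 2] of the values of [Psi (E x)], which is Lipschitz. *)
  assert (U2 : Psi (E x) (h * INR i) - eps / 2 <= E x (h * INR i)).
  { apply mcshane_ge; [specialize (LPb (h * INR i)); lra|].
    intros j Hj. pose proof (Hx j Hj) as Hj'. apply Rabs_le_between in Hj'. unfold F in Hj'.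
    pose proof (LPl (h * INR i) (h * INR j)) as Hij. apply Rabs_le_between in Hij. lra. }
  pose proof (Hx i Hi) as Hi'. apply Rabs_le_between in Hi'. unfold F in Hi'.
  pose proof (LPl t (h * INR i)) as V1. pose proof (LEl t (h * INR i)) as V2.
  apply Rabs_le_between in V1, V2.
  assert (L * Rabs (t - h * INR i) <= eps / 4) by nra.
  apply Rabs_le. lra.
Qed.
End Schauder.

(** * Compactness and Schauder's theorem *)

Lemma ultrafilter_lim (U : (nat -> Prop) -> Prop) (b : R) (x : nat -> R) :
  (forall A B : nat -> Prop, U A -> U B -> U (fun n => A n /\ B n)) ->
  (forall A B : nat -> Prop, (forall n, A n -> B n) -> U A -> U B) ->
  (forall A : nat -> Prop, U A \/ U (fun n => ~ A n)) ->
  (forall A : nat -> Prop, U A -> exists n, A n) ->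
  (forall n, 0 <= x n <= b) ->
  exists l, forall e, 0 < e -> U (fun n => Rabs (x n - l) < e).
Proof.
  intros UI US UU UE Hx.
  assert (UT : U (fun _ => True)).
  { destruct (UU (fun _ => True)) as [H|H]; [exact H|]. destruct (UE _ H) as [n Hn]. now destruct Hn. }
  (* The limit is the supremum of the levels that lie below [x n] for [U]-almost every [n]. *)
  destruct (completeness (fun y => U (fun n => y <= x n))) as [l [Hl1 Hl2]].
  - exists b. intros y Hy. destruct (UE _ Hy) as [n Hn]. specialize (Hx n). lra.
  - exists 0. apply US with (2 := UT). intros n _. apply Hx.
  - exists l. intros e He.
    assert (A : U (fun n => x n < l + e)).
    { destruct (UU (fun n => l + e <= x n)) as [H|H].
      - apply Hl1 in H. lra.
      - apply US with (2 := H). intros n Hn. lra. }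
    assert (B : U (fun n => l - e < x n)).
    { destruct (UU (fun n => l - e < x n)) as [H|H]; [exact H|exfalso].
      assert (l <= l - e); [|lra]. apply Hl2. intros y Hy.
      destruct (UE _ (UI _ _ H Hy)) as [n Hn]. lra. }
    apply US with (2 := UI _ _ A B). intros n Hn. apply Rabs_def1; lra.
Qed.

(** Arzela-Ascoli along one ultrafilter: the pointwise limits exist for all [t] at once, without
    diagonal extraction, and inherit the Lipschitz bounds. Closeness at finitely many nodes then
    becomes uniform closeness; freeness of [U] allows the index to be beyond [N]. *)
Lemma lip_cluster (T L b : R) (us : nat -> R -> R) : 0 < T -> 0 <= L ->
  (forall n, lip L b (us n)) ->
  exists u, lip L b u /\ forall e N, 0 < e ->
    exists n, (N <= n)%nat /\ forall t, 0 <= t <= T -> Rabs (us n t - u t) <= e.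
Proof.
  intros HT HL Hus.
  destruct Ultrafilter.free_ultrafilter as (U & UN & UI & US & UU & UE).
  assert (H0 : forall t, exists l, forall e, 0 < e -> U (fun n => Rabs (us n t - l) < e)).
  { intros t. apply ultrafilter_lim with (b := b); auto. intros n. apply Hus. }
  destruct (boolp.choice H0) as [u Hu].
  assert (Hlip : lip L b u).
  { split.
    - intros t. split; apply Rnot_lt_le; intros H.
      + destruct (UE _ (Hu t (0 - u t) ltac:(lra))) as [n Hn]. destruct (Hus n) as [A _].
        specialize (A t). apply Rabs_def2 in Hn. lra.
      + destruct (UE _ (Hu t (u t - b) ltac:(lra))) as [n Hn]. destruct (Hus n) as [A _].
        specialize (A t). apply Rabs_def2 in Hn. lra.
    - intros s t. apply Rnot_lt_le; intros H.
      set (e := (Rabs (u s - u t) - L * Rabs (s - t)) / 2).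
      assert (He : 0 < e) by (unfold e; lra).
      destruct (UE _ (UI _ _ (Hu s e He) (Hu t e He))) as [n [A B]].
      destruct (Hus n) as [_ C]. specialize (C s t).
      assert (Rabs (u s - u t) <= Rabs (us n s - u s) + Rabs (us n t - u t) + Rabs (us n s - us n t)).
      { replace (u s - u t) with (- (us n s - u s) + (us n t - u t) + (us n s - us n t)) by ring.
        eapply Rle_trans; [apply Rabs_triang|]. apply Rplus_le_compat_r.
        eapply Rle_trans; [apply Rabs_triang|]. rewrite Rabs_Ropp. lra. }
      unfold e in *. lra. }
  exists u. split; [exact Hlip|]. intros e N He.
  destruct (inv_nat_lt (e / (4 * T * (L + 1)))) as [m [Hm Hme]].
  { apply Rdiv_lt_0_compat; nra. }
  set (h := T / INR m).
  assert (Hm0 : 0 < INR m) by now apply lt_0_INR.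
  assert (Hh : 0 < h) by (apply Rdiv_lt_0_compat; lra).
  assert (HLh : L * h <= e / 4).
  { apply Rlt_le in Hme. apply Rmult_le_compat_l with (r := T * (L + 1)) in Hme; [|nra].
    replace (T * (L + 1) * (e / (4 * T * (L + 1)))) with (e / 4) in Hme by (field; lra).
    replace (T * (L + 1) * / INR m) with (h * (L + 1)) in Hme by (unfold h; field; lra). nra. }
  assert (Hall : forall k, U (fun n => forall i, (i < k)%nat -> Rabs (us n (h * INR i) - u (h * INR i)) < e / 2)).
  { induction k as [|k IH].
    - apply US with (2 := UN O). intros; lia.
    - apply US with (2 := UI _ _ IH (Hu (h * INR k) (e / 2) ltac:(lra))).
      intros n [A B] i Hi. destruct (Nat.eq_dec i k) as [->|Ne]; [exact B|]. apply A. lia. }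
  destruct (UE _ (UI _ _ (UN N) (Hall (S m)))) as [n [Hn1 Hn2]].
  exists n. split; [exact Hn1|]. intros t Ht.
  destruct (near_node T m t HT Hm Ht) as [i [Hi [_ Hti]]]. fold h in Hti.
  specialize (Hn2 i Hi). destruct (Hus n) as [_ C]. destruct Hlip as [_ D].
  specialize (C t (h * INR i)). specialize (D t (h * INR i)).
  assert (L * Rabs (t - h * INR i) <= e / 4) by nra.
  apply Rabs_def2 in Hn2. apply Rabs_le_between in C, D. apply Rabs_le. lra.
Qed.

Lemma schauder_lip (T L b : R) (Psi : (R -> R) -> R -> R) :
  0 < T -> 0 <= L -> 0 < b ->
  (forall u, lip L b u -> lip L b (Psi u)) ->
  (forall eps, 0 < eps -> exists delta, 0 < delta /\
    forall u v, lip L b u -> lip L b v ->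
    (forall t, 0 <= t <= T -> Rabs (u t - v t) <= delta) ->
    forall t, 0 <= t <= T -> Rabs (Psi u t - Psi v t) <= eps) ->
  exists u, lip L b u /\ forall t, 0 <= t <= T -> Psi u t = u t.
Proof.
  intros HT HL Hb Hlip Hcont.
  assert (H0 : forall n : nat, exists u, lip L b u /\
    forall t, 0 <= t <= T -> Rabs (Psi u t - u t) <= / INR (S n)).
  { intros n. apply approx_fixed_function; auto.
    apply Rinv_0_lt_compat, lt_0_INR. lia. }
  destruct (boolp.choice H0) as [us Hus].
  destruct (lip_cluster T L b us HT HL (fun n => proj1 (Hus n))) as [u [Hu Hc]].
  exists u. split; [exact Hu|]. intros t Ht.
  apply Rminus_diag_uniq. apply NNPP. intros Hne.
  (* Three errors of size at most [e] arise: the defect of [us n], the continuity of [Psi], and the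
     distance from [us n] to [u]. Together they stay below [4 * e]. *)
  set (e := Rabs (Psi u t - u t) / 4).
  assert (He : 0 < e) by (pose proof (Rabs_pos_lt _ Hne); unfold e; lra).
  destruct (Hcont e He) as [d [Hd HPsi]].
  destruct (inv_nat_lt e He) as [N [HN HNe]].
  destruct (Hc (Rmin d e) N) as [n [Hn Hclose]]; [apply Rmin_glb_lt; lra|].
  destruct (Hus n) as [Ln En]. specialize (En t Ht).
  assert (/ INR (S n) <= / INR N).
  { apply Rinv_le_contravar; [now apply lt_0_INR|]. apply le_INR. lia. }
  assert (A : Rabs (Psi (us n) t - Psi u t) <= e).
  { apply HPsi; auto. intros s Hs. eapply Rle_trans; [now apply Hclose|apply Rmin_l]. }
  assert (B : Rabs (us n t - u t) <= e).
  { eapply Rle_trans; [now apply Hclose|apply Rmin_r]. }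
  assert (Rabs (Psi u t - u t) <= 3 * e); [|unfold e in *; lra].
  apply Rabs_le_between in En, A, B. apply Rabs_le. lra.
Qed.

(** * The linear boundary value problem *)

Definition concave_on (T : R) (u : R -> R) : Prop :=
  forall x y z, 0 <= x -> x < y -> y < z -> z <= T ->
  (z - y) * u x + (y - x) * u z <= (z - x) * u y.

Lemma ex_RInt_cont (f : R -> R) (a b : R) : (forall t, continuous f t) -> ex_RInt f a b.
Proof. intros H. apply (ex_RInt_continuous (V := R_CompleteNormedModule)). auto. Qed.

Lemma is_derive_prim (f : R -> R) (a t : R) :
  (forall t, continuous f t) -> is_derive (fun t => RInt f a t) t (f t).
Proof.
  intros H. apply is_derive_RInt with (a := a); [|apply H].
  apply filter_forall. intros x. apply (RInt_correct (V := R_CompleteNormedModule)).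
  now apply ex_RInt_cont.
Qed.

Lemma is_derive_cont (f : R -> R) (t l : R) : is_derive f t l -> continuous f t.
Proof. intros H. apply (ex_derive_continuous (V := R_NormedModule)). now exists l. Qed.

Lemma RInt_of_derive (F f : R -> R) (a b : R) :
  (forall t, is_derive F t (f t)) -> (forall t, continuous f t) -> RInt f a b = F b - F a.
Proof.
  intros H1 H2. apply is_RInt_unique, (is_RInt_derive (V := R_CompleteNormedModule)); auto.
Qed.

Lemma concave_of_derive (T : R) (u du : R -> R) :
  (forall t, is_derive u t (du t)) ->
  (forall x y, 0 <= x -> x <= y -> y <= T -> du y <= du x) -> concave_on T u.
Proof.
  intros Hd Hdec x y z Hx Hxy Hyz Hz.
  assert (Hc : forall t, continuity_pt u t).
  { intros t. apply continuity_pt_filterlim, (is_derive_cont _ _ _ (Hd t)). }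
  destruct (MVT_gen u x y du) as [c [Hc1 Ec]]; auto.
  destruct (MVT_gen u y z du) as [d [Hd1 Ed]]; auto.
  rewrite Rmin_left, Rmax_right in Hc1, Hd1 by lra.
  assert (du d <= du c) by (apply Hdec; lra).
  assert ((z - y) * (y - x) * du d <= (z - y) * (y - x) * du c)
    by (apply Rmult_le_compat_l; [apply Rmult_le_pos; lra|lra]).
  nra.
Qed.

(** The graph lies above its chord. This turns the integral condition at [T] into a pointwise
    comparison of [u T] with [u eta]. *)
Lemma concave_trapezoid (T eta : R) (u : R -> R) : 0 < eta <= T ->
  (forall t, continuous u t) -> concave_on T u ->
  eta * (u 0 + u eta) / 2 <= RInt u 0 eta.
Proof.
  intros He Hc Hu.
  set (s := (u eta - u 0) / eta).
  assert (Hl : forall t, is_derive (fun t => u 0 * t + s * t ^ 2 / 2) t (u 0 + s * t)).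
  { intros t. auto_derive; [exact I|field]. }
  assert (Hlc : forall t, continuous (fun t => u 0 + s * t) t).
  { intros t. apply (is_derive_cont _ t s). auto_derive; [exact I|ring]. }
  replace (eta * (u 0 + u eta) / 2) with (RInt (fun t => u 0 + s * t) 0 eta).
  - apply RInt_le; [lra|now apply ex_RInt_cont|now apply ex_RInt_cont|].
    intros x Hx. specialize (Hu 0 x eta ltac:(lra) ltac:(lra) ltac:(lra) ltac:(lra)).
    apply Rmult_le_reg_l with eta; [lra|].
    replace (eta * (u 0 + s * x)) with ((eta - x) * u 0 + (x - 0) * u eta) by (unfold s; field; lra).
    lra.
  - rewrite (RInt_of_derive _ _ _ _ Hl Hlc). unfold s. match goal with |- ?a = ?b => change (@eq R a b) end. field. lra.
Qed.

(** * Concave functions under the boundary conditions *)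

Section BVP.
Variables (T eta alpha beta : R).
Hypotheses (Heta : 0 < eta < T) (Halpha : 0 < alpha) (Hbeta : 0 <= beta)
  (Hae : alpha * eta ^ 2 < 2 * T).
(** Common numerator of [Lambda1] and [Lambda2]; its positivity is the upper bound on [beta] with
    the denominator cleared. *)
Definition bdet : R := (2 * T - alpha * eta ^ 2) - beta * (alpha * eta ^ 2 - 2 * eta + 2 * T).
Hypothesis HD : 0 < bdet.

(** The expression equals [bdet + 2 * beta * (T - eta)]. *)
Lemma denom_pos : 0 < 2 * T - alpha * (beta + 1) * eta ^ 2.
Proof using HD Hbeta Heta. unfold bdet in HD. nra. Qed.

Lemma gamma_bounds : 0 < gamma T eta alpha beta < 1.
Proof using HD Hbeta Heta Halpha.
  pose proof denom_pos as Hd. unfold gamma.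
  assert (0 < alpha * (beta + 1) * eta) by (apply Rmult_lt_0_compat; [nra|lra]).
  split.
  - repeat apply Rmin_glb_lt; apply Rdiv_lt_0_compat; nra.
  - eapply Rle_lt_trans; [apply Rmin_l|]. apply Rlt_div_l; lra.
Qed.

Section Concave.
Variable u : R -> R.
Hypotheses (Hc : forall t, continuous u t) (Hu : concave_on T u)
  (B0 : u 0 = beta * u eta) (BT : u T = alpha * RInt u 0 eta).

Lemma concave_bvp_end : alpha * (beta + 1) * eta / 2 * u eta <= u T.
Proof using Hc Hu B0 BT Heta Halpha.
  pose proof (concave_trapezoid T eta u ltac:(lra) Hc Hu) as H.
  rewrite BT. rewrite B0 in H. apply Rmult_le_compat_l with (r := alpha) in H; lra.
Qed.

(** Concavity at 0, [eta], [T], after inserting [u 0 = beta * u eta] and the lower bound on [u T],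
    reads [0 <= bdet / 2 * u eta]. *)
Lemma concave_bvp_mid : 0 <= u eta.
Proof using Hc Hu B0 BT Heta Halpha HD Hbeta.
  pose proof concave_bvp_end as H1.
  pose proof (Hu 0 eta T ltac:(lra) ltac:(lra) ltac:(lra) ltac:(lra)) as H2.
  rewrite B0 in H2. apply Rnot_lt_le. intros Hn.
  assert (eta * (alpha * (beta + 1) * eta / 2 * u eta) <= eta * u T)
    by (apply Rmult_le_compat_l; lra).
  assert (0 < bdet * - u eta) by (apply Rmult_lt_0_compat; lra).
  unfold bdet in *. nra.
Qed.

Lemma concave_bvp_nonneg (t : R) : 0 <= t <= T -> 0 <= u t.
Proof using Hc Hu B0 BT Heta Halpha HD Hbeta.
  intros Ht. pose proof concave_bvp_mid as H1. pose proof concave_bvp_end as H2.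
  assert (H0 : 0 <= u 0) by (rewrite B0; nra).
  assert (HT : 0 <= u T).
  { eapply Rle_trans; [|exact H2]. repeat apply Rmult_le_pos; lra. }
  destruct (Req_dec t 0) as [->|]; [exact H0|].
  destruct (Req_dec t T) as [->|]; [exact HT|].
  pose proof (Hu 0 t T ltac:(lra) ltac:(lra) ltac:(lra) ltac:(lra)) as Hch.
  assert (0 <= (T - t) * u 0) by (apply Rmult_le_pos; lra).
  assert (0 <= (t - 0) * u T) by (apply Rmult_le_pos; lra).
  apply Rnot_lt_le. intros Hn. nra.
Qed.

(** By concavity the minimum over [[eta, T]] is at an end point. If the maximum [M] is attained at
    [tau >= eta], the chord from 0 gives [u eta >= eta / T * M], and [u T >= k * u eta] gives the
    second term of [gamma]. If [tau < eta], then [u T <= u eta]; the chord from [tau] to [T] gives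
    [(T - eta) * M <= T * u eta - eta * u T], and eliminating [u eta] by [k * u eta <= u T] gives
    the third term. *)
Lemma concave_bvp_gamma (tau : R) : 0 <= tau <= T -> (forall t, 0 <= t <= T -> u t <= u tau) ->
  forall t, eta <= t <= T -> gamma T eta alpha beta * u tau <= u t.
Proof using Hc Hu B0 BT Heta Halpha HD Hbeta.
  intros Htau Hmax.
  pose proof concave_bvp_mid as H1. pose proof concave_bvp_end as H2.
  pose proof denom_pos as Hd. pose proof gamma_bounds as Hg.
  pose proof (concave_bvp_nonneg tau Htau) as HM.
  pose proof (concave_bvp_nonneg 0 ltac:(lra)) as H0.
  set (M := u tau) in *. set (k := alpha * (beta + 1) * eta / 2) in *.
  assert (Hk : 0 < k) by (unfold k; assert (0 < alpha * (beta + 1)) by nra; nra).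
  assert (G1 : gamma T eta alpha beta * M <= eta / T * M)
    by (apply Rmult_le_compat_r; [exact HM|apply Rmin_l]).
  assert (G2 : gamma T eta alpha beta * M <= k * eta / T * M).
  { apply Rmult_le_compat_r; [exact HM|]. eapply Rle_trans; [apply Rmin_r|].
    eapply Rle_trans; [apply Rmin_l|]. right. unfold k. field. lra. }
  assert (G3 : gamma T eta alpha beta * M <= k * (T - eta) / (T - k * eta) * M).
  { apply Rmult_le_compat_r; [exact HM|]. eapply Rle_trans; [apply Rmin_r|].
    eapply Rle_trans; [apply Rmin_r|]. right. unfold k. field. lra. }
  assert (Hke : 0 < T - k * eta) by (unfold k; lra).
  assert (Ends : gamma T eta alpha beta * M <= u eta /\ gamma T eta alpha beta * M <= u T).
  { destruct (Rle_lt_dec eta tau) as [Hc1|Hc1].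
    - assert (A : eta / T * M <= u eta).
      { apply Rle_trans with (eta / tau * M).
        - apply Rmult_le_compat_r; [exact HM|]. unfold Rdiv.
          apply Rmult_le_compat_l; [lra|]. apply Rinv_le_contravar; lra.
        - destruct (Req_dec eta tau) as [E|E].
          + subst tau. unfold M. right. field. lra.
          + pose proof (Hu 0 eta tau ltac:(lra) ltac:(lra) ltac:(lra) ltac:(lra)) as H. fold M in H.
            assert (0 <= (tau - eta) * u 0) by (apply Rmult_le_pos; lra).
            replace (eta / tau * M) with (eta * M / tau) by (field; lra).
            apply Rle_div_l; lra. }
      split; [lra|]. eapply Rle_trans; [exact G2|]. eapply Rle_trans; [|exact H2].
      replace (k * eta / T * M) with (k * (eta / T * M)) by (field; lra).
      apply Rmult_le_compat_l; lra.
    - pose proof (Hu tau eta T ltac:(lra) ltac:(lra) ltac:(lra) ltac:(lra)) as H. fold M in H.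
      pose proof (Hmax eta ltac:(lra)) as Hm. 
      assert (HTM : u T <= M) by (apply Hmax; lra).
      assert (Hdec : u T <= u eta) by nra.
      assert (HMT : (T - eta) * M <= T * u eta - eta * u T) by nra.
      assert (k * ((T - eta) * M) <= (T - k * eta) * u T) by nra.
      assert (A : k * (T - eta) / (T - k * eta) * M <= u T).
      { replace (k * (T - eta) / (T - k * eta) * M) with (k * ((T - eta) * M) / (T - k * eta)) by (field; lra).
        apply Rle_div_l; lra. }
      split; lra. }
  intros t Ht. destruct (Req_dec t eta) as [->|]; [apply Ends|].
  destruct (Req_dec t T) as [->|]; [apply Ends|].
  pose proof (Hu eta t T ltac:(lra) ltac:(lra) ltac:(lra) ltac:(lra)) as Hch.
  destruct Ends as [E1 E2].
  apply Rmult_le_compat_l with (r := T - t) in E1; [|lra].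
  apply Rmult_le_compat_l with (r := t - eta) in E2; [|lra].
  apply Rmult_le_reg_l with (T - eta); lra.
Qed.
End Concave.

(** * The linear solution operator and its estimates *)

Definition prim (g : R -> R) (t : R) : R := RInt g 0 t.
Definition prim2 (g : R -> R) (t : R) : R := prim (prim g) t.
Definition prim3 (g : R -> R) (t : R) : R := prim (prim2 g) t.

Definition bvp_slope (g : R -> R) : R :=
  2 / bdet * ((1 - beta) * (prim2 g T - alpha * prim3 g eta)
              + beta * (1 - alpha * eta) * prim2 g eta).
Definition bvp_init (g : R -> R) : R :=
  2 / bdet * (beta * eta * (prim2 g T - alpha * prim3 g eta)
              - beta * (T - alpha * eta ^ 2 / 2) * prim2 g eta).
(* The solution of [u'' = - g] under both boundary conditions: [u = A + B t - prim2 g]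
   with [(A, B)] from the resulting 2x2 linear system, of determinant [bdet / 2]. *)
Definition bvp_sol (g : R -> R) (t : R) : R := bvp_init g + bvp_slope g * t - prim2 g t.

Section Linear.
Variable g : R -> R.
Hypothesis Hg : forall t, continuous g t.

Lemma is_derive_prim1 t : is_derive (prim g) t (g t).
Proof using Hg. now apply is_derive_prim. Qed.

Lemma prim_cont t : continuous (prim g) t.
Proof using Hg. apply (is_derive_cont _ _ _ (is_derive_prim1 t)). Qed.

Lemma is_derive_prim2 t : is_derive (prim2 g) t (prim g t).
Proof using Hg. apply is_derive_prim. exact prim_cont. Qed.

Lemma prim2_cont t : continuous (prim2 g) t.
Proof using Hg. apply (is_derive_cont _ _ _ (is_derive_prim2 t)). Qed.

Lemma is_derive_prim3 t : is_derive (prim3 g) t (prim2 g t).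
Proof using Hg. apply is_derive_prim. exact prim2_cont. Qed.

Lemma prim_0 (h : R -> R) : prim h 0 = 0.
Proof. apply (RInt_point (V := R_CompleteNormedModule)). Qed.

Lemma is_derive_bvp_sol t : is_derive (bvp_sol g) t (bvp_slope g - prim g t).
Proof using Hg.
  unfold bvp_sol. apply (is_derive_minus (V := R_NormedModule)); [|apply is_derive_prim2].
  auto_derive; [exact I|ring].
Qed.

Lemma is_derive2_bvp_sol t : is_derive (fun t => bvp_slope g - prim g t) t (- g t).
Proof using Hg.
  replace (- g t) with (0 - g t) by ring.
  apply (is_derive_minus (V := R_NormedModule)); [|apply is_derive_prim1].
  apply (is_derive_const (V := R_NormedModule)).
Qed.

Lemma bvp_sol_cont t : continuous (bvp_sol g) t.
Proof using Hg. apply (is_derive_cont _ _ _ (is_derive_bvp_sol t)). Qed.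

Lemma bvp_sol_0 : bvp_sol g 0 = beta * bvp_sol g eta.
Proof using Heta HD Hg.
  unfold bvp_sol. assert (E : prim2 g 0 = 0) by apply prim_0. rewrite E.
  unfold bvp_init, bvp_slope. unfold bdet in *. field. lra.
Qed.

Lemma bvp_sol_T : bvp_sol g T = alpha * RInt (bvp_sol g) 0 eta.
Proof using Heta HD Hg.
  rewrite (RInt_of_derive (fun t => bvp_init g * t + bvp_slope g * t ^ 2 / 2 - prim3 g t)).
  - assert (E : prim3 g 0 = 0) by apply prim_0. rewrite E.
    unfold bvp_sol, bvp_init, bvp_slope. unfold bdet in *. field. lra.
  - intros t. unfold bvp_sol.
    apply (is_derive_minus (V := R_NormedModule)); [|apply is_derive_prim3].
    auto_derive; [exact I|field].
  - exact bvp_sol_cont.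
Qed.

Lemma prim_nonneg (h : R -> R) t : (forall t, continuous h t) ->
  0 <= t <= T -> (forall s, 0 <= s <= T -> 0 <= h s) -> 0 <= prim h t.
Proof.
  intros Hh Ht H. apply RInt_ge_0; [lra|now apply ex_RInt_cont|].
  intros x Hx. apply H. lra.
Qed.

(** Cauchy's formula for repeated integration; it links [prim2] to the weighted integrals in
    [Lambda1] and [Lambda2]. *)
Lemma prim2_eq c : prim2 g c = RInt (fun s => (c - s) * g s) 0 c.
Proof using Hg.
  rewrite (RInt_of_derive (fun t => (c - t) * prim g t + prim2 g t)).
  - assert (E : prim2 g 0 = 0) by apply prim_0. rewrite E, prim_0. ring.
  - intros t.
    replace ((c - t) * g t) with ((- 1 * prim g t + (c - t) * g t) + prim g t) by ring.
    apply (is_derive_plus (V := R_NormedModule)); [|apply is_derive_prim2].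
    apply (is_derive_mult (fun t => c - t) (prim g)); [|apply is_derive_prim1|intros; apply Rmult_comm].
    auto_derive; [exact I|ring].
  - intros t. apply (continuous_mult (fun t => c - t) g); [|apply Hg].
    apply (is_derive_cont _ t (-1)). auto_derive; [exact I|ring].
Qed.

Hypothesis Hpos : forall t, 0 <= t <= T -> 0 <= g t.

Lemma prim_mono x y : 0 <= x -> x <= y -> y <= T -> prim g x <= prim g y.
Proof using Hg Hpos.
  intros Hx Hxy Hy. unfold prim.
  rewrite <- (RInt_Chasles g 0 x y) by now apply ex_RInt_cont.
  assert (0 <= RInt g x y).
  { apply RInt_ge_0; [lra|now apply ex_RInt_cont|]. intros; apply Hpos; lra. }
  unfold plus; simpl. lra.
Qed.

Lemma bvp_sol_concave : concave_on T (bvp_sol g).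
Proof using Hg Hpos.
  apply (concave_of_derive T _ _ is_derive_bvp_sol).
  intros x y H1 H2 H3. pose proof (prim_mono x y H1 H2 H3). lra.
Qed.

(** [prim2 g] is convex and vanishes at 0: the trapezoid over its chord bounds its integral from
    above, and its slope from the origin increases. *)
Lemma prim2_facts : 0 <= prim3 g eta /\ prim3 g eta <= eta * prim2 g eta / 2 /\
  0 <= prim2 g eta /\ T * prim2 g eta <= eta * prim2 g T.
Proof using Hg Hpos Heta.
  assert (P1 : forall t, 0 <= t <= T -> 0 <= prim g t).
  { intros t Ht. apply prim_nonneg; auto. }
  assert (P2 : forall t, 0 <= t <= T -> 0 <= prim2 g t).
  { intros t Ht. apply prim_nonneg; auto using prim_cont. }
  assert (Hcv : concave_on T (fun t => - prim2 g t)).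
  { apply (concave_of_derive T _ (fun t => - prim g t)).
    - intros t. apply (is_derive_opp (V := R_NormedModule)), is_derive_prim2.
    - intros x y H1 H2 H3. pose proof (prim_mono x y H1 H2 H3). lra. }
  assert (E : prim2 g 0 = 0) by apply prim_0.
  split; [apply prim_nonneg; auto using prim2_cont; lra|].
  split; [|split; [apply P2; lra|]].
  - pose proof (concave_trapezoid T eta (fun t => - prim2 g t) ltac:(lra)) as H.
    rewrite (RInt_opp (V := R_CompleteNormedModule)) in H by (apply ex_RInt_cont, prim2_cont).
    cbv beta in H. rewrite E in H. unfold prim3, prim.
    enough (eta * (- 0 + - prim2 g eta) / 2 <= - RInt (prim2 g) 0 eta) by lra.
    apply H; [|exact Hcv]. intros t. apply (continuous_opp (V := R_NormedModule)), prim2_cont.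
  - pose proof (Hcv 0 eta T ltac:(lra) ltac:(lra) ltac:(lra) ltac:(lra)) as H. cbv beta in H; rewrite E in H. lra.
Qed.

(** The bracket is that of [Lambda1]. Intercept and slope are bounded separately by discarding
    negative terms and using [prim2 g eta <= W] and [prim3 g eta <= T * W / 2], where
    [W = prim2 g T]. *)
Lemma bvp_sol_upper t : 0 <= t <= T ->
  bvp_sol g t <= / bdet * ((2 * (beta + 1) + / T * beta * eta * (alpha * eta + 2) + alpha * beta * T)
                           * (T * prim2 g T)).
Proof using Hg Hpos Heta HD Hbeta Halpha Hae.
  intros Ht. destruct prim2_facts as (F1 & F2 & F3 & F4).
  set (W := prim2 g T) in *. set (w := prim2 g eta) in *. set (z := prim3 g eta) in *.
  assert (P1 : 0 <= prim2 g t).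
  { apply prim_nonneg; auto using prim_cont. intros s Hs. apply prim_nonneg; auto. }
  assert (HwW : w <= W) by nra.
  assert (HzW : z <= T * W / 2) by nra.
  assert (HA : bvp_init g <= 2 / bdet * (beta * eta * W + beta * (alpha * eta ^ 2 / 2) * W)).
  { unfold bvp_init. fold W w z.
    assert (0 < 2 / bdet) by (apply Rdiv_lt_0_compat; lra).
    apply Rmult_le_compat_l; [lra|].
    assert (0 <= beta * eta) by nra.
    assert (0 <= beta * eta * (alpha * z)) by (apply Rmult_le_pos; nra).
    assert (0 <= beta * (T - alpha * eta ^ 2 / 2) * w) by (repeat apply Rmult_le_pos; lra).
    assert (0 <= beta * (alpha * eta ^ 2 / 2) * W) by (repeat apply Rmult_le_pos; nra).
    lra. }
  assert (HB : bvp_slope g <= 2 / bdet * (W + beta * alpha * (T * W / 2) + beta * W)).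
  { unfold bvp_slope. fold W w z.
    assert (0 < 2 / bdet) by (apply Rdiv_lt_0_compat; lra).
    apply Rmult_le_compat_l; [lra|].
    assert (0 <= alpha * z) by nra. assert (0 <= beta * W) by nra.
    assert (beta * alpha * z <= beta * alpha * (T * W / 2)) by (apply Rmult_le_compat_l; nra).
    assert (beta * w <= beta * W) by (apply Rmult_le_compat_l; lra).
    assert (0 <= beta * (alpha * eta) * w) by (repeat apply Rmult_le_pos; nra).
    lra. }
  set (B := 2 / bdet * (W + beta * alpha * (T * W / 2) + beta * W)) in *.
  assert (HB0 : 0 <= B).
  { unfold B. assert (0 < 2 / bdet) by (apply Rdiv_lt_0_compat; lra).
    apply Rmult_le_pos; [lra|].
    assert (0 <= beta * alpha * (T * W / 2)) by (repeat apply Rmult_le_pos; nra). nra. }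
  apply Rle_trans with (2 / bdet * (beta * eta * W + beta * (alpha * eta ^ 2 / 2) * W) + B * T).
  - unfold bvp_sol. assert (bvp_slope g * t <= B * T) by nra. lra.
  - right. unfold B. field. lra.
Qed.

(** At [eta] the solution is [2 / bdet] times [eta * prim2 g T - T * prim2 g eta] plus a term
    nonnegative by the trapezoid bound. The part of the difference coming from [[0, eta]] is
    nonnegative since [T * (eta - s) <= eta * (T - s)], which leaves the integral over
    [[eta, T]]. *)
Lemma bvp_sol_lower : 2 * eta / bdet * RInt (fun s => (T - s) * g s) eta T <= bvp_sol g eta.
Proof using Hg Hpos Heta HD Hbeta Halpha Hae.
  destruct prim2_facts as (F1 & F2 & F3 & F4).
  assert (E : bvp_sol g eta = / bdet * 2 * (eta * prim2 g T - T * prim2 g eta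
             + alpha * eta * (eta * prim2 g eta / 2 - prim3 g eta))).
  { unfold bvp_sol, bvp_init, bvp_slope. unfold bdet in *. field. lra. }
  assert (Hcm : forall c t, continuous (fun s => (c - s) * g s) t).
  { intros c t. apply (continuous_mult (fun t => c - t) g); [|apply Hg].
    apply (is_derive_cont _ t (-1)). auto_derive; [exact I|ring]. }
  assert (I1 : prim2 g T = RInt (fun s => (T - s) * g s) 0 eta + RInt (fun s => (T - s) * g s) eta T).
  { rewrite prim2_eq. symmetry. apply (RInt_Chasles (V := R_CompleteNormedModule));
      apply ex_RInt_cont, Hcm. }
  assert (I2 : T * prim2 g eta <= eta * RInt (fun s => (T - s) * g s) 0 eta).
  { rewrite prim2_eq.
    rewrite <- !(RInt_scal (V := R_CompleteNormedModule)) by apply ex_RInt_cont, Hcm.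
    apply RInt_le; [lra| | |].
    - apply (ex_RInt_scal (V := R_NormedModule)), ex_RInt_cont, Hcm.
    - apply (ex_RInt_scal (V := R_NormedModule)), ex_RInt_cont, Hcm.
    - intros x Hx. unfold scal; simpl; unfold mult; simpl.
      pose proof (Hpos x ltac:(lra)). assert (0 <= x * (T - eta)) by (apply Rmult_le_pos; lra). nra. }
  rewrite E. assert (0 < / bdet) by now apply Rinv_0_lt_compat.
  replace (2 * eta / bdet * RInt (fun s => (T - s) * g s) eta T)
    with (/ bdet * 2 * (eta * RInt (fun s => (T - s) * g s) eta T)) by (unfold Rdiv; ring).
  apply Rmult_le_compat_l; [lra|].
  assert (0 <= alpha * eta * (eta * prim2 g eta / 2 - prim3 g eta)) by (apply Rmult_le_pos; nra).
  rewrite I1. lra.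
Qed.
End Linear.

Lemma prim_bound (h : R -> R) s t : (forall t, continuous h t) -> 0 <= t <= T ->
  (forall x, 0 <= x <= T -> Rabs (h x) <= s) -> Rabs (prim h t) <= T * s.
Proof.
  intros Hh Ht H. apply Rle_trans with ((t - 0) * s).
  - apply abs_RInt_le_const; [lra|now apply ex_RInt_cont|]. intros x Hx. apply H. lra.
  - assert (0 <= s) by (eapply Rle_trans; [apply Rabs_pos|apply (H 0); lra]). nra.
Qed.

(** No sign is imposed on [g], so that differences can be estimated; the bound on the derivative
    supplies the Lipschitz constant of Schauder's class. *)
Lemma bvp_sol_bound : exists K, 0 <= K /\ forall g s, (forall t, continuous g t) ->
  (forall t, 0 <= t <= T -> Rabs (g t) <= s) ->
  forall t, 0 <= t <= T -> Rabs (bvp_sol g t) <= K * s /\ Rabs (bvp_slope g - prim g t) <= K * s.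
Proof using Heta HD.
  set (T3 := T * (T * T)).
  set (KX := T * T + Rabs alpha * T3).
  set (KB := Rabs (2 / bdet) * (Rabs (1 - beta) * KX + Rabs (beta * (1 - alpha * eta)) * (T * T))).
  set (KA := Rabs (2 / bdet) * (Rabs (beta * eta) * KX
              + Rabs (beta * (T - alpha * eta ^ 2 / 2)) * (T * T))).
  assert (0 < T * T) by nra. assert (0 < T3) by (unfold T3; nra).
  pose proof (Rabs_pos alpha).
  assert (0 <= KX) by (unfold KX; nra).
  assert (HKB : 0 <= KB).
  { unfold KB. pose proof (Rabs_pos (2 / bdet)). pose proof (Rabs_pos (1 - beta)).
    pose proof (Rabs_pos (beta * (1 - alpha * eta))). apply Rmult_le_pos; nra. }
  assert (HKA : 0 <= KA).
  { unfold KA. pose proof (Rabs_pos (2 / bdet)). pose proof (Rabs_pos (beta * eta)).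
    pose proof (Rabs_pos (beta * (T - alpha * eta ^ 2 / 2))). apply Rmult_le_pos; nra. }
  exists (KA + KB * T + KB + T * T + T). split; [nra|].
  intros g s Hg Hs.
  assert (Hs0 : 0 <= s) by (eapply Rle_trans; [apply Rabs_pos|apply (Hs 0); lra]).
  assert (P1 : forall t, 0 <= t <= T -> Rabs (prim g t) <= T * s).
  { intros t Ht. now apply prim_bound. }
  assert (P2 : forall t, 0 <= t <= T -> Rabs (prim2 g t) <= T * T * s).
  { intros t Ht. rewrite Rmult_assoc. apply prim_bound; auto using prim_cont. }
  assert (P3 : Rabs (prim3 g eta) <= T3 * s).
  { unfold T3. rewrite Rmult_assoc. apply prim_bound; auto using prim2_cont. lra. }
  assert (PX : Rabs (prim2 g T - alpha * prim3 g eta) <= KX * s).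
  { eapply Rle_trans; [apply Rabs_triang|]. rewrite Rabs_Ropp, Rabs_mult.
    pose proof (P2 T ltac:(lra)). unfold KX.
    assert (Rabs alpha * Rabs (prim3 g eta) <= Rabs alpha * (T3 * s))
      by (apply Rmult_le_compat_l; lra). lra. }
  assert (Hlin : forall p q, Rabs (2 / bdet * (p * (prim2 g T - alpha * prim3 g eta) + q * prim2 g eta))
    <= Rabs (2 / bdet) * (Rabs p * KX + Rabs q * (T * T)) * s).
  { intros p q. rewrite Rabs_mult, Rmult_assoc. apply Rmult_le_compat_l; [apply Rabs_pos|].
    eapply Rle_trans; [apply Rabs_triang|]. rewrite !Rabs_mult.
    pose proof (P2 eta ltac:(lra)).
    assert (Rabs p * Rabs (prim2 g T - alpha * prim3 g eta) <= Rabs p * (KX * s))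
      by (apply Rmult_le_compat_l; [apply Rabs_pos|lra]).
    assert (Rabs q * Rabs (prim2 g eta) <= Rabs q * (T * T * s))
      by (apply Rmult_le_compat_l; [apply Rabs_pos|lra]). lra. }
  assert (PB : Rabs (bvp_slope g) <= KB * s) by apply Hlin.
  assert (PA : Rabs (bvp_init g) <= KA * s).
  { unfold bvp_init, KA. rewrite <- (Rabs_Ropp (beta * (T - alpha * eta ^ 2 / 2))).
    eapply Rle_trans; [|apply Hlin]. right. f_equal. ring. }
  intros t Ht. specialize (P1 t Ht). specialize (P2 t Ht).
  assert (Rabs (bvp_slope g * t) <= KB * s * T).
  { rewrite Rabs_mult, (Rabs_pos_eq t) by lra. pose proof (Rabs_pos (bvp_slope g)). nra. }
  apply Rabs_le_between in PA, PB, P1, P2, H3.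
  assert (0 <= KA * s) by nra. assert (0 <= KB * s) by nra.
  assert (0 <= T * s) by nra. assert (0 <= T * T * s) by nra. assert (0 <= KB * s * T) by nra.
  unfold bvp_sol. split; apply Rabs_le; lra.
Qed.

Lemma prim_minus (g h : R -> R) t : (forall t, continuous g t) -> (forall t, continuous h t) ->
  prim (fun s => g s - h s) t = prim g t - prim h t.
Proof.
  intros Hg Hh. unfold prim. apply (RInt_minus (V := R_CompleteNormedModule)); now apply ex_RInt_cont.
Qed.

Lemma bvp_sol_minus (g h : R -> R) t : (forall t, continuous g t) -> (forall t, continuous h t) ->
  bvp_sol (fun s => g s - h s) t = bvp_sol g t - bvp_sol h t.
Proof.
  intros Hg Hh.
  assert (P2 : forall t, prim2 (fun s => g s - h s) t = prim2 g t - prim2 h t).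
  { intros r. unfold prim2. rewrite <- prim_minus by auto using prim_cont.
    unfold prim at 1 3. apply RInt_ext. intros x _. now apply prim_minus. }
  assert (P3 : forall t, prim3 (fun s => g s - h s) t = prim3 g t - prim3 h t).
  { intros r. unfold prim3. rewrite <- prim_minus by auto using prim2_cont.
    unfold prim. apply RInt_ext. intros x _. apply P2. }
  unfold bvp_sol, bvp_init, bvp_slope. rewrite !P2, P3. ring.
Qed.
End BVP.

(** * The nonlinear problem *)

Definition clamp (T t : R) : R := Rmax 0 (Rmin t T).

Lemma clamp_in (T t : R) : 0 <= T -> 0 <= clamp T t <= T.
Proof. intros HT. unfold clamp, Rmax, Rmin. destruct (Rle_dec t T), (Rle_dec 0 _); lra. Qed.

Lemma clamp_id (T t : R) : 0 <= t <= T -> clamp T t = t.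
Proof. intros Ht. unfold clamp, Rmax, Rmin. destruct (Rle_dec t T), (Rle_dec 0 _); lra. Qed.

Lemma clamp_close (T s t : R) : Rabs (clamp T s - clamp T t) <= Rabs (s - t).
Proof.
  unfold clamp, Rmax, Rmin.
  destruct (Rle_dec s T), (Rle_dec t T); repeat destruct (Rle_dec 0 _);
    unfold Rabs; repeat destruct (Rcase_abs _); lra.
Qed.

Lemma lip1_continuous (L : R) (h : R -> R) :
  (forall s t, Rabs (h s - h t) <= L * Rabs (s - t)) -> forall t, continuous h t.
Proof.
  intros H t. apply continuity_pt_filterlim. intros e He.
  assert (HL : 0 < Rabs L + 1) by (pose proof (Rabs_pos L); lra).
  exists (e / (Rabs L + 1)). split; [apply Rdiv_lt_0_compat; lra|].
  intros x [_ Hx]. simpl in *. unfold R_dist in *.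
  apply Rle_lt_trans with ((Rabs L + 1) * Rabs (x - t)).
  - eapply Rle_trans; [apply H|]. apply Rmult_le_compat_r; [apply Rabs_pos|].
    pose proof (Rle_abs L). lra.
  - apply Rmult_lt_compat_l with (r := Rabs L + 1) in Hx; [|exact HL].
    replace ((Rabs L + 1) * (e / (Rabs L + 1))) with e in Hx by (field; lra). exact Hx.
Qed.

(** Used with [p] a retraction onto [D], to replace [a] and [f] by functions continuous on the whole
    line. *)
Lemma continuous_on_comp (D : R -> Prop) (h p : R -> R) :
  continuous_on D h -> (forall x, D (p x)) -> (forall x, continuous p x) ->
  forall x, continuous (fun x => h (p x)) x.
Proof.
  intros Hh HD Hp x.
  apply (filterlim_comp _ _ _ p h _ (within D (locally (p x))) _); [|now apply Hh].
  intros P HP. specialize (Hp x _ HP). unfold filtermap in *.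
  apply filter_imp with (2 := Hp). intros y Hy. apply Hy, HD.
Qed.

Lemma sup_norm_attained (T : R) (u : R -> R) : 0 <= T -> (forall t, continuous u t) ->
  (forall t, 0 <= t <= T -> 0 <= u t) ->
  exists tau, 0 <= tau <= T /\ sup_norm T u = u tau /\ forall t, 0 <= t <= T -> u t <= u tau.
Proof.
  intros HT Hc Hpos.
  destruct (continuity_ab_maj u 0 T HT) as [tau [Hmax Htau]].
  { intros c _. apply continuity_pt_filterlim, Hc. }
  exists tau. split; [exact Htau|]. split; [|exact Hmax].
  unfold sup_norm. rewrite (is_lub_Rbar_unique _ (Finite (u tau))); [reflexivity|].
  split.
  - intros y [t [Ht ->]]. simpl. rewrite Rabs_pos_eq by now apply Hpos. now apply Hmax.
  - intros y Hy. apply Hy. exists tau. split; [exact Htau|].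
    rewrite Rabs_pos_eq; [reflexivity|now apply Hpos].
Qed.

Lemma concave_pos (T : R) (u : R -> R) (tau : R) : concave_on T u ->
  (forall t, 0 <= t <= T -> 0 <= u t) -> 0 <= tau <= T -> 0 < u tau ->
  forall t, 0 < t < T -> 0 < u t.
Proof.
  intros Hu Hpos Htau Hm t Ht.
  destruct (Rtotal_order t tau) as [H|[H|H]].
  - pose proof (Hu 0 t tau ltac:(lra) ltac:(lra) ltac:(lra) ltac:(lra)) as Hch.
    pose proof (Hpos 0 ltac:(lra)).
    assert (0 <= (tau - t) * u 0) by (apply Rmult_le_pos; lra).
    assert (0 < (t - 0) * u tau) by (apply Rmult_lt_0_compat; lra).
    apply Rnot_le_lt. intros Hn. nra.
  - now subst.
  - pose proof (Hu tau t T ltac:(lra) ltac:(lra) ltac:(lra) ltac:(lra)) as Hch.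
    pose proof (Hpos T ltac:(lra)).
    assert (0 <= (t - tau) * u T) by (apply Rmult_le_pos; lra).
    assert (0 < (T - t) * u tau) by (apply Rmult_lt_0_compat; lra).
    apply Rnot_le_lt. intros Hn. nra.
Qed.

Lemma continuous_2d_comp (H : R -> R -> R) (p q : R -> R) (t : R) :
  continuity_2d_pt H (p t) (q t) -> continuous p t -> continuous q t ->
  continuous (fun s => H (p s) (q s)) t.
Proof.
  intros HH Hp Hq. apply continuity_2d_pt_filterlim in HH.
  apply (continuous_comp_2 p q H t Hp Hq). exact HH.
Qed.

(** * Fixed points of the nonlinear integral operator *)

Section Problem.
Variables (T eta alpha beta : R).
Hypotheses (Heta : 0 < eta < T) (Halpha : 0 < alpha) (Hbeta : 0 <= beta)
  (Hae : alpha * eta ^ 2 < 2 * T) (HD : 0 < bdet T eta alpha beta).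
Local Notation G := (bvp_sol T eta alpha beta).
Local Notation D := (bdet T eta alpha beta).
Local Notation gam := (gamma T eta alpha beta).

Lemma bvp_sol_nonneg g t : (forall t, continuous g t) -> (forall t, 0 <= t <= T -> 0 <= g t) ->
  0 <= t <= T -> 0 <= G g t.
Proof using Heta Halpha Hbeta HD.
  intros Hg Hp. apply (concave_bvp_nonneg T eta alpha beta); auto.
  - intros s. now apply bvp_sol_cont.
  - apply bvp_sol_concave; auto.
  - now apply bvp_sol_0.
  - now apply bvp_sol_T.
Qed.

Lemma bvp_sol_scal k g t : (forall t, continuous g t) -> G (fun s => k * g s) t = k * G g t.
Proof using Type.
  intros Hg.
  assert (P : forall h r, (forall t, continuous h t) -> prim (fun s => k * h s) r = k * prim h r).
  { intros h r Hh. apply (RInt_scal (V := R_CompleteNormedModule)). now apply ex_RInt_cont. }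
  assert (P2 : forall r, prim2 (fun s => k * g s) r = k * prim2 g r).
  { intros r. unfold prim2. rewrite <- P by (intros; now apply prim_cont).
    f_equal. apply functional_extensionality. intros x. now apply P. }
  assert (P3 : forall r, prim3 (fun s => k * g s) r = k * prim3 g r).
  { intros r. unfold prim3. rewrite <- P by (intros; now apply prim2_cont).
    f_equal. apply functional_extensionality. intros x. apply P2. }
  unfold bvp_sol, bvp_init, bvp_slope. rewrite !P2, P3. ring.
Qed.

Variables a f : R -> R.
Hypotheses (Ha : forall t, continuous a t) (Ha0 : forall t, 0 <= a t)
  (Hf : forall x, continuous f x) (Hf0 : forall x, 0 <= f x).

(** The nonlinearity sees the maximum [m] of the unknown besides its values, and the image is cut
    off at [b]. The caller must show that the cut-off is inactive. *)
Lemma hammerstein (b C : R) (H : R -> R -> R) : 0 < b ->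
  (forall m x, 0 <= m <= b -> 0 <= x <= b -> continuity_2d_pt H m x) ->
  (forall m x, 0 <= m <= b -> 0 <= x <= b -> 0 <= H m x <= C) ->
  exists v m tau, (forall t, continuous v t) /\ (forall t, 0 <= v t <= b) /\
    0 <= tau <= T /\ v tau = m /\ (forall t, 0 <= t <= T -> v t <= m) /\
    forall t, 0 <= t <= T -> v t = Rmin b (G (fun s => a s * H m (v s)) t).
Proof using Heta Halpha Hbeta HD Ha Ha0.
  intros Hb Hcont HC.
  destruct (bvp_sol_bound T eta alpha beta Heta HD) as [K [HK HKb]].
  destruct (continuity_ab_maj a 0 T ltac:(lra)) as [ta [Hta _]].
  { intros c _. apply continuity_pt_filterlim, Ha. }
  set (A := a ta) in *. assert (HA : 0 <= A) by apply Ha0.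
  assert (HC0 : 0 <= C) by (destruct (HC 0 0); lra).
  (* [A * C] bounds the integrand, so [L] bounds the derivative of the image. *)
  set (L := K * (A * C)). assert (HL : 0 <= L) by (unfold L; repeat apply Rmult_le_pos; lra).
  set (g := fun v s => a s * H (sup_norm T v) (v s)).
  (* Freezing the argument outside [[0, T]] makes the image Lipschitz on the whole line. *)
  set (Psi := fun v t => Rmin b (G (g v) (clamp T t))).
  assert (Hvc : forall v, lip L b v -> forall t, continuous v t).
  { intros v [_ Hv]. now apply lip1_continuous with L. }
  assert (Hsup : forall v, lip L b v -> exists tau, 0 <= tau <= T /\ sup_norm T v = v tau /\
             forall t, 0 <= t <= T -> v t <= v tau).
  { intros v Hv. apply sup_norm_attained; [lra|now apply Hvc|]. intros; apply Hv. }
  assert (Hsb : forall v, lip L b v -> 0 <= sup_norm T v <= b).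
  { intros v Hv. destruct (Hsup v Hv) as [tau [_ [-> _]]]. apply Hv. }
  assert (Hgc : forall v, lip L b v -> forall t, continuous (g v) t).
  { intros v Hv t. apply (continuous_mult a); [apply Ha|].
    apply (continuous_2d_comp H (fun _ => sup_norm T v) v).
    - apply Hcont; [now apply Hsb|apply Hv].
    - apply continuous_const.
    - now apply Hvc. }
  assert (Hgb : forall v, lip L b v -> forall t, 0 <= t <= T -> 0 <= g v t <= A * C).
  { intros v Hv t Ht. pose proof (Ha0 t). pose proof (Hta t Ht).
    destruct (HC (sup_norm T v) (v t) (Hsb v Hv) (proj1 Hv t)). unfold g. split.
    - now apply Rmult_le_pos.
    - now apply Rmult_le_compat. }
  destruct (schauder_lip T L b Psi) as [v [Hv Hfix]]; [lra|lra|lra| | |].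
  - intros v Hv. split.
    + intros t. unfold Psi. split; [|apply Rmin_l]. apply Rmin_glb; [lra|].
      apply bvp_sol_nonneg; [now apply Hgc|intros; now apply Hgb|apply clamp_in; lra].
    + intros s t. unfold Psi. apply Rmin_close.
      { replace (b - b) with 0 by ring. rewrite Rabs_R0. pose proof (Rabs_pos (s - t)). nra. }
      apply Rle_trans with (L * Rabs (clamp T s - clamp T t)).
      2: { apply Rmult_le_compat_l; [lra|apply clamp_close]. }
      destruct (MVT_gen (G (g v)) (clamp T t) (clamp T s)
                  (fun t => bvp_slope T eta alpha beta (g v) - prim (g v) t)) as [c [Hc E]].
      { intros x _. apply is_derive_bvp_sol. now apply Hgc. }
      { intros x _. apply continuity_pt_filterlim, bvp_sol_cont. now apply Hgc. }
      rewrite E, Rabs_mult. apply Rmult_le_compat_r; [apply Rabs_pos|].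
      apply (HKb (g v) (A * C)); [now apply Hgc| |].
      * intros r Hr. destruct (Hgb v Hv r Hr). rewrite Rabs_pos_eq; lra.
      * pose proof (clamp_in T s ltac:(lra)). pose proof (clamp_in T t ltac:(lra)).
        unfold Rmin, Rmax in Hc. destruct (Rle_dec _ _); lra.
  - intros eps Heps. set (e := eps / (K * A + 1)).
    assert (HKA : 0 <= K * A) by (apply Rmult_le_pos; lra).
    assert (He : 0 < e) by (apply Rdiv_lt_0_compat; lra).
    destruct (uniform_continuity_2d H 0 b 0 b Hcont (mkposreal e He)) as [d Hd]. simpl in Hd.
    exists (d / 2). pose proof (cond_pos d). split; [lra|].
    intros u v Hu Hv Huv t Ht. unfold Psi. apply Rmin_close.
    { replace (b - b) with 0 by ring. rewrite Rabs_R0. lra. }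
    rewrite clamp_id by exact Ht.
    rewrite <- bvp_sol_minus by now apply Hgc.
    apply Rle_trans with (K * (A * e)).
    + apply HKb; [| |exact Ht].
      * intros r. apply (continuous_minus (V := R_NormedModule)); now apply Hgc.
      * intros r Hr. unfold g. rewrite <- Rmult_minus_distr_l, Rabs_mult.
        rewrite (Rabs_pos_eq (a r)) by apply Ha0.
        apply Rmult_le_compat; [apply Ha0|apply Rabs_pos|now apply Hta|].
        apply Rlt_le, Hd.
        -- now apply Hsb.
        -- apply Hv.
        -- now apply Hsb.
        -- apply Hu.
        (* The maximum is 1-Lipschitz in the uniform distance: evaluate each function at the other's
           maximiser. *)
        -- destruct (Hsup u Hu) as [p [Hp [-> Mp]]]. destruct (Hsup v Hv) as [q [Hq [-> Mq]]].
           pose proof (Huv p Hp) as Up. pose proof (Huv q Hq) as Uq.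
           apply Rabs_le_between in Up, Uq. specialize (Mp q Hq). specialize (Mq p Hp).
           apply Rabs_def1; lra.
        -- eapply Rle_lt_trans; [now apply Huv|lra].
    + replace eps with ((K * A + 1) * e) by (unfold e; field; lra). nra.
  - destruct (Hsup v Hv) as [tau [Htau [E Hmax]]].
    exists v, (v tau), tau. split; [now apply Hvc|]. split; [apply Hv|]. split; [exact Htau|].
    split; [reflexivity|]. split; [exact Hmax|].
    intros t Ht. rewrite <- (Hfix t Ht) at 1. unfold Psi. rewrite clamp_id by exact Ht.
    unfold g. now rewrite E.
Qed.

Definition weight : R := RInt (fun s => (T - s) * a s) eta T.
Hypothesis Hw : 0 < weight.

Lemma weight_cont t : continuous (fun s => (T - s) * a s) t.
Proof using Ha.
  apply (continuous_mult (fun t => T - t) a); [|apply Ha].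
  apply (is_derive_cont _ t (-1)). auto_derive; [exact I|ring].
Qed.

Lemma lambda1_eq : Lambda1 T eta alpha beta a =
  D / ((2 * (beta + 1) + / T * beta * eta * (alpha * eta + 2) + alpha * beta * T) * (T * prim2 a T)).
Proof using Ha.
  unfold Lambda1. fold D. do 2 f_equal. rewrite prim2_eq by exact Ha.
  rewrite <- (RInt_scal (V := R_CompleteNormedModule)) by (apply ex_RInt_cont, weight_cont).
  apply RInt_ext. intros x _. unfold scal; simpl; unfold mult; simpl. ring.
Qed.

Lemma prim2_weight_pos : 0 < prim2 a T.
Proof using Hw Ha Ha0 Heta.
  rewrite prim2_eq by exact Ha.
  rewrite <- (RInt_Chasles (V := R_CompleteNormedModule) _ 0 eta T) by (apply ex_RInt_cont, weight_cont).
  fold weight. assert (0 <= RInt (fun s => (T - s) * a s) 0 eta).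
  { apply RInt_ge_0; [lra|apply ex_RInt_cont, weight_cont|].
    intros x Hx. apply Rmult_le_pos; [lra|apply Ha0]. }
  unfold plus; simpl. lra.
Qed.

Lemma lambda1_den_pos :
  0 < (2 * (beta + 1) + / T * beta * eta * (alpha * eta + 2) + alpha * beta * T) * (T * prim2 a T).
Proof using Hw Ha Ha0 Heta Halpha Hbeta.
  pose proof prim2_weight_pos.
  assert (0 < / T) by (apply Rinv_0_lt_compat; lra).
  assert (0 <= / T * beta * eta * (alpha * eta + 2)) by (repeat apply Rmult_le_pos; nra).
  assert (0 <= alpha * beta * T) by (repeat apply Rmult_le_pos; lra).
  apply Rmult_lt_0_compat; [lra|nra].
Qed.

Lemma lambda1_pos : 0 < Lambda1 T eta alpha beta a.
Proof using Hw Ha Ha0 Heta Halpha Hbeta HD.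
  rewrite lambda1_eq. apply Rdiv_lt_0_compat; [exact HD|exact lambda1_den_pos].
Qed.

(** [Lambda1] is the reciprocal of the upper bound of [bvp_sol_upper] for the integrand [a]. *)
Lemma bvp_sol_le (h : R -> R) (r t : R) : (forall t, continuous h t) ->
  (forall t, 0 <= t <= T -> 0 <= h t <= Lambda1 T eta alpha beta a * r) ->
  0 <= t <= T -> G (fun s => a s * h s) t <= r.
Proof using Hw Ha Ha0 Heta Halpha Hbeta HD Hae.
  intros Hh Hb Ht. set (mu := Lambda1 T eta alpha beta a * r) in *.
  assert (Hc : forall t, continuous (fun s => a s * h s) t).
  { intros s. apply (continuous_mult a h); auto. }
  eapply Rle_trans.
  { apply bvp_sol_upper; auto. intros s Hs. apply Rmult_le_pos; [apply Ha0|now apply Hb]. }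
  assert (P : prim2 (fun s => a s * h s) T <= mu * prim2 a T).
  { rewrite !prim2_eq by auto.
    rewrite <- (RInt_scal (V := R_CompleteNormedModule)) by (apply ex_RInt_cont, weight_cont).
    apply RInt_le; [lra| | |].
    - apply ex_RInt_cont. intros s. apply (continuous_mult (fun t => T - t)); [|apply Hc].
      apply (is_derive_cont _ s (-1)). auto_derive; [exact I|ring].
    - apply (ex_RInt_scal (V := R_NormedModule)), ex_RInt_cont, weight_cont.
    - intros x Hx. unfold scal; simpl; unfold mult; simpl.
      destruct (Hb x ltac:(lra)). pose proof (Ha0 x).
      assert (0 <= (T - x) * a x) by (apply Rmult_le_pos; lra). nra. }
  pose proof lambda1_den_pos as HQ. pose proof prim2_weight_pos as HP.
  unfold mu in *. rewrite lambda1_eq in P.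
  set (B := 2 * (beta + 1) + / T * beta * eta * (alpha * eta + 2) + alpha * beta * T) in *.
  assert (HB : 0 < B) by (unfold B; assert (0 < / T) by (apply Rinv_0_lt_compat; lra);
    assert (0 <= / T * beta * eta * (alpha * eta + 2)) by (repeat apply Rmult_le_pos; nra);
    assert (0 <= alpha * beta * T) by (repeat apply Rmult_le_pos; lra); lra).
  apply Rle_trans with (/ D * (B * (T * (D / (B * (T * prim2 a T)) * r * prim2 a T)))).
  - apply Rmult_le_compat_l; [apply Rlt_le, Rinv_0_lt_compat, HD|].
    apply Rmult_le_compat_l; [lra|]. apply Rmult_le_compat_l; [lra|exact P].
  - right. field. repeat split; lra.
Qed.

Lemma lambda2_pos : 0 < Lambda2 T eta alpha beta a.
Proof using Hw Heta Halpha Hbeta HD.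
  pose proof (gamma_bounds T eta alpha beta Heta Halpha Hbeta HD).
  unfold Lambda2. fold D weight. apply Rdiv_lt_0_compat; [exact HD|].
  repeat apply Rmult_lt_0_compat; lra.
Qed.

(** [gam * Lambda2], not [Lambda2], is the reciprocal of the lower bound of [bvp_sol_lower] for the
    integrand [a]. *)
Lemma bvp_sol_ge (h : R -> R) (r : R) : (forall t, continuous h t) ->
  (forall t, 0 <= t <= T -> 0 <= h t) ->
  (forall t, eta <= t <= T -> gam * Lambda2 T eta alpha beta a * r <= h t) ->
  r <= G (fun s => a s * h s) eta.
Proof using Hw Ha Ha0 Heta Halpha Hbeta HD Hae.
  intros Hh Hp Hb. set (mu := gam * Lambda2 T eta alpha beta a * r) in *.
  pose proof (gamma_bounds T eta alpha beta Heta Halpha Hbeta HD).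
  assert (Hc : forall t, continuous (fun s => a s * h s) t).
  { intros s. apply (continuous_mult a h); auto. }
  eapply Rle_trans.
  2: { apply bvp_sol_lower; auto. intros s Hs. apply Rmult_le_pos; [apply Ha0|now apply Hp]. }
  assert (P : mu * weight <= RInt (fun s => (T - s) * (a s * h s)) eta T).
  { unfold weight.
    rewrite <- (RInt_scal (V := R_CompleteNormedModule)) by (apply ex_RInt_cont, weight_cont).
    apply RInt_le; [lra| | |].
    - apply (ex_RInt_scal (V := R_NormedModule)), ex_RInt_cont, weight_cont.
    - apply ex_RInt_cont. intros s. apply (continuous_mult (fun t => T - t)); [|apply Hc].
      apply (is_derive_cont _ s (-1)). auto_derive; [exact I|ring].
    - intros x Hx. unfold scal; simpl; unfold mult; simpl.
      pose proof (Hb x ltac:(lra)). pose proof (Ha0 x).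
      assert (0 <= (T - x) * a x) by (apply Rmult_le_pos; lra). nra. }
  apply Rle_trans with (2 * eta / D * (mu * weight)).
  - right. unfold mu, Lambda2. fold D weight. field. repeat split; lra.
  - apply Rmult_le_compat_l; [|exact P]. apply Rlt_le, Rdiv_lt_0_compat; lra.
Qed.

(** Such a fixed point would exceed its own maximum at [eta]: on [[eta, T]] the term [f (w s) + c]
    is at least [nu], owing to [c] if the maximum is at most [rho - delta] and to [f] otherwise, and
    this gives [w eta >= r > rho]. *)
Lemma no_fixed_point_below (rho M2 : R) : 0 < rho -> Lambda2 T eta alpha beta a <= M2 ->
  (forall x, gam * rho <= x <= rho -> M2 * rho <= f x) ->
  exists delta nu, 0 < delta /\ 0 < nu /\ forall w c tau, (forall t, continuous w t) ->
    (forall t, 0 <= t <= T -> w t = G (fun s => a s * (f (w s) + c)) t) ->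
    0 <= tau <= T -> (forall t, 0 <= t <= T -> w t <= w tau) -> w tau <= rho ->
    0 <= c -> (w tau <= rho - delta -> nu <= c) -> False.
Proof using Hw Ha Ha0 Hf Hf0 Heta Halpha Hbeta HD Hae.
  intros Hr HM2 Hi.
  pose proof (gamma_bounds T eta alpha beta Heta Halpha Hbeta HD) as Hg.
  pose proof lambda2_pos as HL.
  set (Lam := Lambda2 T eta alpha beta a) in *.
  (* Midpoint of [rho] and [rho / gam]: [r > rho] yields the contradiction, and [gam * r < rho] puts
     [nu] strictly below [Lam * rho]. *)
  set (r := rho * (/ gam + 1) / 2).
  assert (Hgi : 1 < / gam) by (rewrite <- Rinv_1; apply Rinv_lt_contravar; lra).
  assert (Hrr : rho < r) by (unfold r; nra).
  set (nu := gam * Lam * r).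
  assert (Hnu : nu < Lam * rho).
  { unfold nu, r. replace (gam * Lam * (rho * (/ gam + 1) / 2)) with (Lam * rho * ((1 + gam) / 2)) by (field; lra).
    assert (0 < Lam * rho) by nra. nra. }
  assert (HgL : 0 < gam * Lam) by (apply Rmult_lt_0_compat; lra).
  assert (Hnu0 : 0 < nu) by (apply Rmult_lt_0_compat; lra).
  assert (HM : Lam * rho <= M2 * rho) by nra.
  (* Hypothesis (i) stops at [gam * rho]; continuity there carries the weaker level [nu] down by
     [d], far enough for values at least [gam * w tau] with [w tau > rho - d]. *)
  destruct (proj2 (continuity_pt_filterlim f (gam * rho)) (Hf _) (Lam * rho - nu)) as [d [Hd Hfd]]; [lra|].
  simpl in Hfd. unfold R_dist in Hfd.
  exists d, nu. split; [exact Hd|]. split; [exact Hnu0|].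
  intros w c tau Hwc Hfix Htau Hmax Hle Hc Hcn.
  set (h := fun s => f (w s) + c).
  assert (Hh : forall t, continuous h t).
  { intros t. apply (continuous_plus (V := R_NormedModule)); [|apply continuous_const].
    apply (continuous_comp w f); auto. }
  assert (Hh0 : forall t, 0 <= h t) by (intros t; unfold h; pose proof (Hf0 (w t)); lra).
  set (g := fun s => a s * h s).
  assert (Hgc : forall t, continuous g t) by (intros t; apply (continuous_mult a h); auto).
  assert (Hg0 : forall t, 0 <= g t) by (intros t; apply Rmult_le_pos; auto).
  assert (Hcone : forall t, eta <= t <= T -> gam * w tau <= w t).
  { intros t Ht. rewrite (Hfix tau Htau), (Hfix t) by lra.
    apply (concave_bvp_gamma T eta alpha beta) with (u := G g); auto.
    - intros s. now apply bvp_sol_cont.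
    - apply bvp_sol_concave; auto.
    - now apply bvp_sol_0.
    - now apply bvp_sol_T.
    - intros s Hs. change (G g) with (G (fun s => a s * (f (w s) + c))).
      rewrite <- (Hfix s Hs), <- (Hfix tau Htau). now apply Hmax. }
  assert (Hlow : r <= G g eta).
  { apply bvp_sol_ge; auto. fold Lam nu. intros t Ht. unfold h. pose proof (Hf0 (w t)).
    destruct (Rle_lt_dec (w tau) (rho - d)) as [Hs|Hs]; [specialize (Hcn Hs); lra|].
    specialize (Hcone t Ht). pose proof (Hmax t ltac:(lra)).
    destruct (Rle_lt_dec (gam * rho) (w t)) as [Hx|Hx].
    - pose proof (Hi (w t) ltac:(lra)). lra.
    - assert (Hdist : gam * rho - w t < d) by nra.
      pose proof (Hi (gam * rho) ltac:(nra)) as Hfr.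
      assert (Hclose : Rabs (f (w t) - f (gam * rho)) < Lam * rho - nu).
      { apply Hfd. split; [split; [exact I|lra]|]. apply Rabs_def1; lra. }
      apply Rabs_def2 in Hclose. lra. }
  pose proof (Hfix eta ltac:(lra)) as E. change (w eta = G g eta) in E.
  pose proof (Hmax eta ltac:(lra)). lra.
Qed.

Lemma bounded_on (r : R) : 0 <= r -> exists C, 0 <= C /\ forall x, 0 <= x <= r -> f x <= C.
Proof using Hf Hf0.
  intros Hr. destruct (continuity_ab_maj f 0 r Hr) as [x [Hx _]].
  { intros c _. apply continuity_pt_filterlim, Hf. }
  exists (f x). split; [apply Hf0|exact Hx].
Qed.

Lemma continuity_2d_of_continuous_1 (h : R -> R) x y :
  (forall t, continuous h t) -> continuity_2d_pt (fun m _ => h m) x y.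
Proof.
  intros Hh. apply (continuity_1d_2d_pt_comp h (fun m _ => m)).
  - apply continuity_pt_filterlim, Hh.
  - apply continuity_2d_pt_id1.
Qed.

Lemma Rmax_continuous c t : continuous (fun t => Rmax c t) t.
Proof.
  apply (lip1_continuous 1). intros s r.
  unfold Rmax, Rabs. destruct (Rle_dec c s), (Rle_dec c r);
    repeat destruct (Rcase_abs _); lra.
Qed.

Lemma ramp_continuous k r t : continuous (fun m => k * Rmax 0 (r - m)) t.
Proof.
  apply (continuous_scal_r (V := R_NormedModule) k).
  apply (continuous_comp (fun m => r - m) (Rmax 0)); [|apply Rmax_continuous].
  apply (is_derive_cont _ t (-1)). auto_derive; [exact I|ring].
Qed.

Lemma fixed_point_above (rho M2 q b : R) : 0 < rho -> Lambda2 T eta alpha beta a <= M2 ->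
  (forall x, gam * rho <= x <= rho -> M2 * rho <= f x) ->
  rho < b -> q < 1 -> (forall x, 0 <= x <= b -> f x <= Lambda1 T eta alpha beta a * (q * b)) ->
  exists w tau, (forall t, continuous w t) /\
    (forall t, 0 <= t <= T -> w t = G (fun s => a s * f (w s)) t) /\
    0 <= tau <= T /\ (forall t, 0 <= t <= T -> w t <= w tau) /\ rho < w tau.
Proof using Hw Ha Ha0 Hf Hf0 Heta Halpha Hbeta HD Hae.
  intros Hr HM2 Hi Hb Hq Hfb.
  destruct (no_fixed_point_below rho M2 Hr HM2 Hi) as (delta & nu & Hd & Hnu & Hno).
  (* The slope is the one for which [c m >= nu] as soon as [m <= rho - delta]. *)
  set (c := fun m => nu / delta * Rmax 0 (rho - m)).
  assert (Hk : 0 < nu / delta) by (apply Rdiv_lt_0_compat; lra).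
  assert (Hc0 : forall m, 0 <= c m) by (intros m; apply Rmult_le_pos; [lra|apply Rmax_l]).
  destruct (bounded_on b ltac:(lra)) as [C [HC HCb]].
  destruct (hammerstein b (C + nu / delta * rho) (fun m x => f x + c m)) as
    (v & m & tau & Hvc & Hvb & Htau & Em & Hmax & Hfix); [lra| | |].
  { intros m x Hm Hx. apply continuity_2d_pt_plus.
    - apply (continuity_1d_2d_pt_comp f (fun _ x => x)).
      + apply continuity_pt_filterlim, Hf.
      + apply continuity_2d_pt_id2.
    - apply continuity_2d_of_continuous_1. apply ramp_continuous. }
  { intros m x Hm Hx. pose proof (Hf0 x). pose proof (Hc0 m). pose proof (HCb x Hx).
    split; [lra|]. apply Rplus_le_compat; [lra|]. apply Rmult_le_compat_l; [lra|].
    apply Rmax_lub; lra. }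
  (* If [m <= rho < b], the cut-off at [b] is inactive and [v] is a fixed point excluded above. *)
  assert (Hlt : rho < m).
  { apply Rnot_le_lt. intros Hm. subst m. apply (Hno v (c (v tau)) tau); auto.
    - intros t Ht. rewrite (Hfix t Ht) at 1. apply Rmin_right.
      specialize (Hfix t Ht). specialize (Hmax t Ht).
      unfold Rmin in Hfix. destruct (Rle_dec b _); lra.
    - intros Hs. unfold c. rewrite Rmax_right by lra.
      apply Rle_trans with (nu / delta * delta); [right; field; lra|].
      apply Rmult_le_compat_l; lra. }
  assert (Hcm : c m = 0) by (unfold c; rewrite Rmax_left by lra; ring).
  exists v, tau. split; [exact Hvc|]. split; [|subst m; auto].
  intros t Ht. rewrite (Hfix t Ht) at 1. rewrite Hcm.
  replace (fun s => a s * (f (v s) + 0)) with (fun s => a s * f (v s))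
    by (apply functional_extensionality; intros s; now rewrite Rplus_0_r).
  apply Rmin_right. apply Rle_trans with (q * b); [|nra].
  apply bvp_sol_le; auto.
  intros s. apply (continuous_comp v f); auto.
Qed.

(* Here the expansion at [rho] is turned into a compression by solving for [v] with
   [w = phi (max v) * v], where [phi] is such that [max v |-> max w] reverses [[r1, rho]]. *)
Lemma fixed_point_below (rho M2 q r1 : R) : 0 < rho -> Lambda2 T eta alpha beta a <= M2 ->
  (forall x, gam * rho <= x <= rho -> M2 * rho <= f x) ->
  0 < r1 < rho -> q < 1 -> (forall x, 0 <= x <= r1 -> f x <= Lambda1 T eta alpha beta a * (q * r1)) ->
  exists w tau, (forall t, continuous w t) /\
    (forall t, 0 <= t <= T -> w t = G (fun s => a s * f (w s)) t) /\
    0 <= tau <= T /\ (forall t, 0 <= t <= T -> w t <= w tau) /\ 0 < w tau < rho.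
Proof using Hw Ha Ha0 Hf Hf0 Heta Halpha Hbeta HD Hae.
  intros Hr HM2 Hi Hr1 Hq Hfb.
  destruct (no_fixed_point_below rho M2 Hr HM2 Hi) as (delta & nu & Hd & Hnu & Hno).
  (* For [m <= r1] the maximum of [w] is [rho / r1 * m], so [kap * (r1 - m)] is [nu / delta] times
     the distance from that maximum to [rho]. *)
  set (kap := nu / delta * (rho / r1)).
  assert (Hkap : 0 < kap).
  { unfold kap. apply Rmult_lt_0_compat; apply Rdiv_lt_0_compat; lra. }
  set (c := fun m => kap * Rmax 0 (r1 - m)).
  assert (Hc0 : forall m, 0 <= c m) by (intros m; apply Rmult_le_pos; [lra|apply Rmax_l]).
  (* For [m >= r1] this gives [phi m * m = r1 + rho - m], the reflection of [[r1, rho]]; below [r1]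
     the factor is frozen at [rho / r1]. *)
  set (phi := fun m => (r1 + rho) / Rmax r1 m - 1).
  assert (Hmx : forall m, r1 <= Rmax r1 m) by (intros; apply Rmax_l).
  assert (Hphi : forall m, m <= rho -> r1 / rho <= phi m <= rho / r1).
  { intros m Hm. pose proof (Hmx m). assert (Rmax r1 m <= rho) by (apply Rmax_lub; lra).
    unfold phi. split.
    - apply Rle_trans with ((r1 + rho) / rho - 1); [right; field; lra|].
      apply Rplus_le_compat_r. unfold Rdiv. apply Rmult_le_compat_l; [lra|]. apply Rinv_le_contravar; lra.
    - apply Rle_trans with ((r1 + rho) / r1 - 1); [|right; field; lra].
      apply Rplus_le_compat_r. unfold Rdiv. apply Rmult_le_compat_l; [lra|]. apply Rinv_le_contravar; lra. }
  assert (Hphc : forall m, continuous phi m).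
  { intros m. apply (continuous_minus (V := R_NormedModule)); [|apply continuous_const].
    apply (continuous_scal_r (V := R_NormedModule) (r1 + rho) (fun m => / Rmax r1 m)).
    apply continuous_Rinv_comp; [apply Rmax_continuous|]. pose proof (Hmx m). lra. }
  assert (Hlo : 0 < r1 / rho) by (apply Rdiv_lt_0_compat; lra).
  assert (Hhi : 0 < rho / r1) by (apply Rdiv_lt_0_compat; lra).
  set (X := rho / r1 * rho). assert (HX : 0 <= X) by (unfold X; nra).
  destruct (bounded_on X HX) as [C [HC HCb]].
  (* By linearity of [G], dividing by [phi m] makes [w = phi m * v] solve the equation with
     right-hand side [f w + c]. *)
  destruct (hammerstein rho ((C + kap * r1) * (rho / r1)) (fun m x => (f (phi m * x) + c m) * / phi m)) as
    (v & m & tau & Hvc & Hvb & Htau & Em & Hmax & Hfix); [lra| | |].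
  { intros m x Hm Hx. pose proof (Hphi m ltac:(lra)). apply continuity_2d_pt_mult.
    - apply continuity_2d_pt_plus; [|apply continuity_2d_of_continuous_1, ramp_continuous].
      apply (continuity_1d_2d_pt_comp f (fun m x => phi m * x)).
      + apply continuity_pt_filterlim, Hf.
      + apply continuity_2d_pt_mult; [now apply continuity_2d_of_continuous_1|apply continuity_2d_pt_id2].
    - apply continuity_2d_pt_inv; [now apply continuity_2d_of_continuous_1|lra]. }
  { intros m x Hm Hx. pose proof (Hphi m ltac:(lra)) as Hp. pose proof (Hc0 m).
    pose proof (Hf0 (phi m * x)).
    assert (Hfx : f (phi m * x) <= C) by (apply HCb; unfold X; split; nra).
    assert (Hcm : c m <= kap * r1).
    { apply Rmult_le_compat_l; [lra|]. apply Rmax_lub; lra. }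
    assert (Hip : 0 < / phi m) by (apply Rinv_0_lt_compat; lra).
    split; [apply Rmult_le_pos; lra|]. apply Rmult_le_compat; [lra|lra|lra|].
    replace (rho / r1) with (/ (r1 / rho)) by (field; lra). apply Rinv_le_contravar; lra. }
  assert (Hm0 : 0 <= m <= rho) by (subst m; apply Hvb).
  pose proof (Hphi m ltac:(lra)) as Hp.
  set (p := phi m) in *.
  set (w := fun t => p * v t).
  assert (Hwc : forall t, continuous w t).
  { intros t. apply (continuous_scal_r (V := R_NormedModule) p v), Hvc. }
  assert (Hfw : forall t, continuous (fun s => f (w s)) t).
  { intros s. apply (continuous_comp w f); auto. }
  assert (Hpw : forall t, 0 <= t <= T ->
    G (fun s => a s * ((f (w s) + c m) * / p)) t = / p * G (fun s => a s * (f (w s) + c m)) t).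
  { intros t Ht. rewrite <- bvp_sol_scal.
    - f_equal. apply functional_extensionality. intros s. ring.
    - intros s. apply (continuous_mult a (fun s => f (w s) + c m)); [apply Ha|].
      apply (continuous_plus (V := R_NormedModule) (fun s => f (w s))); [apply Hfw|apply continuous_const]. }
  assert (Hg0 : c m = 0 -> (fun s => a s * (f (w s) + c m)) = (fun s => a s * f (w s))).
  { intros E. rewrite E. apply functional_extensionality. intros s. now rewrite Rplus_0_r. }
  (* [m = rho] would mean that [w] has maximum [r1]; compression at [r1] then gives
     [v tau <= q * rho < rho]. Hence the cut-off at [rho] is inactive. *)
  assert (Hlt : m < rho).
  { destruct (Rle_lt_or_eq_dec m rho (proj2 Hm0)) as [Hlt|Heq]; [exact Hlt|exfalso].
    assert (Ep : p = r1 / rho).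
    { unfold p, phi. rewrite Heq, Rmax_right by lra. field. lra. }
    assert (Ec : c m = 0) by (unfold c; rewrite Rmax_left by lra; ring).
    assert (Hle : G (fun s => a s * f (w s)) tau <= q * r1).
    { apply bvp_sol_le; auto. intros t Ht. split; [apply Hf0|]. apply Hfb.
      unfold w. rewrite Ep. destruct (Hvb t). split; [nra|].
      apply Rle_trans with (r1 / rho * rho); [|right; field; lra].
      apply Rmult_le_compat_l; lra. }
    pose proof (Hfix tau Htau) as E. fold p in E. cbv beta in E.
    change (fun s => a s * ((f (p * v s) + c m) * / p)) with (fun s => a s * ((f (w s) + c m) * / p)) in E.
    rewrite (Hpw tau Htau), (Hg0 Ec) in E.
    assert (Hv : v tau <= / p * G (fun s => a s * f (w s)) tau) by (rewrite E at 1; apply Rmin_r).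
    assert (/ p * G (fun s => a s * f (w s)) tau <= q * rho).
    { apply Rle_trans with (/ p * (q * r1)).
      - apply Rmult_le_compat_l; [apply Rlt_le, Rinv_0_lt_compat; lra|exact Hle].
      - rewrite Ep. right. field. lra. }
    nra. }
  assert (Hwfix : forall t, 0 <= t <= T -> w t = G (fun s => a s * (f (w s) + c m)) t).
  { intros t Ht. pose proof (Hfix t Ht) as E. cbv beta in E. fold p in E.
    change (fun s => a s * ((f (p * v s) + c m) * / p)) with (fun s => a s * ((f (w s) + c m) * / p)) in E.
    rewrite (Hpw t Ht) in E. specialize (Hmax t Ht).
    unfold Rmin in E. destruct (Rle_dec rho _) in E; [lra|].
    unfold w at 1. rewrite E. field. lra. }
  assert (Hwmax : forall t, 0 <= t <= T -> w t <= w tau).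
  { intros t Ht. unfold w. rewrite Em. apply Rmult_le_compat_l; [lra|auto]. }
  (* [m <= r1] would make [w] a fixed point with term [c m] and maximum [rho / r1 * m <= rho], which
     [Hno] excludes. *)
  assert (Hgt : r1 < m).
  { apply Rnot_le_lt. intros Hle.
    assert (Ep : p = rho / r1).
    { unfold p, phi. rewrite Rmax_left by lra. field. lra. }
    apply (Hno w (c m) tau); auto.
    - unfold w. rewrite Em, Ep. apply Rle_trans with (rho / r1 * r1); [|right; field; lra].
      apply Rmult_le_compat_l; lra.
    - unfold w, c. rewrite Em, Ep, Rmax_right by lra. intros Hs.
      assert (Hs' : delta <= rho / r1 * (r1 - m)).
      { replace (rho / r1 * (r1 - m)) with (rho - rho / r1 * m) by (field; lra). lra. }
      unfold kap. rewrite Rmult_assoc.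
      apply Rle_trans with (nu / delta * delta); [right; field; lra|].
      apply Rmult_le_compat_l; [apply Rlt_le, Rdiv_lt_0_compat; lra|exact Hs']. }
  assert (Ec : c m = 0) by (unfold c; rewrite Rmax_left by lra; ring).
  exists w, tau. split; [exact Hwc|]. split.
  { intros t Ht. rewrite <- (Hg0 Ec). now apply Hwfix. }
  split; [exact Htau|]. split; [exact Hwmax|].
  assert (Ew : w tau = r1 + rho - m).
  { unfold w, p, phi. rewrite Em, Rmax_right by lra. field. lra. }
  lra.
Qed.
End Problem.

(** * From fixed points to positive solutions *)

Lemma fixed_point_solution (T eta alpha beta : R) (a f a' f' w : R -> R) (tau : R) :
  0 < eta < T -> 0 < alpha -> 0 <= beta -> 0 < bdet T eta alpha beta ->
  (forall t, continuous a t) -> (forall t, 0 <= a t) ->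
  (forall x, continuous f x) -> (forall x, 0 <= f x) ->
  (forall t, 0 <= t <= T -> a' t = a t) -> (forall x, 0 <= x -> f' x = f x) ->
  (forall t, continuous w t) ->
  (forall t, 0 <= t <= T -> w t = bvp_sol T eta alpha beta (fun s => a s * f (w s)) t) ->
  0 <= tau <= T -> (forall t, 0 <= t <= T -> w t <= w tau) -> 0 < w tau ->
  exists u, positive_solution T eta alpha beta a' f' u /\ sup_norm T u = w tau.
Proof.
  intros Heta Halpha Hbeta HD Ha Ha0 Hf Hf0 Ea Ef Hwc Hfix Htau Hmax Hpos.
  set (g := fun s => a s * f (w s)) in *.
  assert (Hg : forall t, continuous g t).
  { intros t. apply (continuous_mult a (fun s => f (w s))); [apply Ha|].
    apply (continuous_comp w f); auto. }
  assert (Hg0 : forall t, 0 <= g t) by (intros t; apply Rmult_le_pos; auto).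
  (* [w] satisfies the fixed point equation only on [[0, T]]; [u] agrees with it there and is twice
     differentiable on the whole line. *)
  set (u := bvp_sol T eta alpha beta g) in *.
  assert (Hu0 : forall t, 0 <= t <= T -> 0 <= u t) by (intros; apply bvp_sol_nonneg; auto).
  assert (Huc : forall t, continuous u t) by (intros t; now apply bvp_sol_cont).
  assert (D1 : forall t, Derive u t = bvp_slope T eta alpha beta g - prim g t).
  { intros t. apply is_derive_unique, is_derive_bvp_sol, Hg. }
  assert (D2 : forall t, is_derive (Derive u) t (- g t)).
  { intros t. apply (is_derive_ext (fun t => bvp_slope T eta alpha beta g - prim g t)).
    - intros s. symmetry. apply D1.
    - apply is_derive2_bvp_sol, Hg. }
  assert (D3 : forall t, Derive_n u 2 t = - g t).
  { intros t. simpl. apply is_derive_unique. apply D2. }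
  exists u. split.
  - split; [|split; [exact Hu0|]].
    + split; [|split; [|split; [|split]]].
      * intros t _. apply (filterlim_filter_le_1 _ (filter_le_within _)). apply Huc.
      * intros t _. split; [|split].
        -- exists (bvp_slope T eta alpha beta g - prim g t). apply is_derive_bvp_sol, Hg.
        -- exists (- g t). apply D2.
        -- apply (continuous_ext (fun t => - g t)); [intros s; now rewrite D3|].
           apply (continuous_opp (V := R_NormedModule)), Hg.
      * intros t Ht. rewrite D3, Ea, Ef by (try apply Hu0; lra). unfold g.
        rewrite (Hfix t) by lra. ring.
      * now apply bvp_sol_0.
      * now apply bvp_sol_T.
    + apply (concave_pos T u tau); auto.
      * apply bvp_sol_concave; auto.
      * rewrite <- Hfix; auto.
  - destruct (sup_norm_attained T u ltac:(lra) Huc Hu0) as [s [Hs [-> Hsm]]].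
    apply Rle_antisym.
    + rewrite <- Hfix by exact Hs. now apply Hmax.
    + rewrite (Hfix tau Htau). now apply Hsm.
Qed.

(** [t0] may be an end point of [[eta, T]], and the weight vanishes at [T]; hence positivity is used
    only inside an interval [[p, q]] cut to fit in [[eta, T]]. *)
Lemma weighted_integral_pos (T eta : R) (a : R -> R) : eta < T ->
  (forall t, continuous a t) -> (forall t, 0 <= a t) ->
  (exists t0, eta <= t0 <= T /\ 0 < a t0) -> 0 < weight T eta a.
Proof.
  intros HT Ha Ha0 [t0 [Ht0 Hp]].
  destruct (proj2 (continuity_pt_filterlim a t0) (Ha _) (a t0) Hp) as [d [Hd H]].
  simpl in H. unfold R_dist in H.
  set (p := Rmax eta (t0 - d / 2)). set (q := Rmin T (t0 + d / 2)).
  assert (Hpq : p < q) by (unfold p, q; apply Rmax_lub_lt; apply Rmin_glb_lt; lra).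
  assert (Hp1 : eta <= p) by apply Rmax_l. assert (Hp2 : t0 - d / 2 <= p) by apply Rmax_r.
  assert (Hq1 : q <= T) by apply Rmin_l. assert (Hq2 : q <= t0 + d / 2) by apply Rmin_r.
  pose proof (weight_cont T a Ha) as Hc.
  assert (Hnn : forall x y, x <= y -> y <= T -> 0 <= RInt (fun s => (T - s) * a s) x y).
  { intros x y Hxy Hy. apply RInt_ge_0; [lra|apply ex_RInt_cont, Hc|].
    intros s Hs. apply Rmult_le_pos; [lra|apply Ha0]. }
  unfold weight.
  rewrite <- (RInt_Chasles (V := R_CompleteNormedModule) _ eta p T) by (apply ex_RInt_cont, Hc).
  rewrite <- (RInt_Chasles (V := R_CompleteNormedModule) _ p q T) by (apply ex_RInt_cont, Hc).
  pose proof (Hnn eta p ltac:(lra) ltac:(lra)). pose proof (Hnn q T ltac:(lra) ltac:(lra)).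
  assert (0 < RInt (fun s => (T - s) * a s) p q).
  { apply RInt_gt_0; [exact Hpq| |intros x _; apply Hc].
    intros x Hx. apply Rmult_lt_0_compat; [lra|].
    destruct (Req_dec x t0) as [->|Hne]; [exact Hp|].
    assert (Rabs (a x - a t0) < a t0) as Hx'.
    { apply H. split; [split; [exact I|now apply not_eq_sym]|]. apply Rabs_def1; lra. }
    apply Rabs_def2 in Hx'. lra. }
  unfold plus; simpl. lra.
Qed.

Lemma linear_bound_at_0 (f : R -> R) (k l r : R) : (forall x, continuous f x) ->
  0 < k -> l < k -> 0 < r -> filterlim (fun x => f x / x) (at_right 0) (locally l) ->
  exists r1, 0 < r1 < r /\ forall x, 0 <= x <= r1 -> f x <= k * r1.
Proof.
  intros Hf Hk Hl Hr Hlim.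
  assert (Hev : locally l (fun y => y < k)) by (apply open_lt; exact Hl).
  destruct (Hlim _ Hev) as [d Hd].
  pose proof (cond_pos d) as Hd0.
  set (r1 := Rmin d r / 2).
  assert (Hr1 : 0 < Rmin d r) by (apply Rmin_glb_lt; lra).
  pose proof (Rmin_l d r). pose proof (Rmin_r d r).
  assert (Hx : forall x, 0 < x <= r1 -> f x <= k * x).
  { intros x Hx. assert (f x / x < k).
    { apply Hd; [|lra]. unfold r1 in Hx. apply Rabs_def1; unfold minus, plus, opp; simpl; lra. }
    apply Rlt_le, Rlt_div_l; lra. }
  exists r1. split; [unfold r1; lra|]. intros x Hx1.
  destruct (Req_dec x 0) as [->|Hne].
  2: { apply Rle_trans with (k * x); [apply Hx; lra|apply Rmult_le_compat_l; lra]. }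
  (* The limit says nothing about the value at 0; continuity transfers the bound from a small
     [y > 0]. *)
  apply Rnot_lt_le. intros Hn.
  destruct (proj2 (continuity_pt_filterlim f 0) (Hf _) (f 0 - k * r1)) as [e [He H2]]; [lra|].
  simpl in H2. unfold R_dist in H2.
  set (y := Rmin e r1 / 2).
  assert (0 < Rmin e r1) by (apply Rmin_glb_lt; unfold r1; lra).
  pose proof (Rmin_l e r1). pose proof (Rmin_r e r1).
  assert (Hy : Rabs (f y - f 0) < f 0 - k * r1).
  { apply H2. split; [split; [exact I|unfold y; lra]|]. apply Rabs_def1; unfold y; lra. }
  apply Rabs_def2 in Hy. pose proof (Hx y ltac:(unfold y; lra)).
  assert (k * y <= k * r1) by (apply Rmult_le_compat_l; unfold y; lra). lra.
Qed.

Lemma linear_bound_at_infinity (f : R -> R) (k l r : R) : (forall x, continuous f x) ->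
  (forall x, 0 <= f x) -> 0 < k -> l < k -> is_lim (fun x => f x / x) p_infty l ->
  exists b, r < b /\ 0 < b /\ forall x, 0 <= x <= b -> f x <= k * b.
Proof.
  intros Hf Hf0 Hk Hl Hlim.
  assert (Hev : locally l (fun y => y < k)) by (apply open_lt; exact Hl).
  destruct (Hlim _ Hev) as [X HX].
  set (X1 := Rmax X 0). pose proof (Rmax_l X 0) as M1. pose proof (Rmax_r X 0) as M2. fold X1 in M1, M2.
  destruct (bounded_on f Hf Hf0 X1 M2) as [C [HC HCb]].
  (* The summand [C / k] gives [C <= k * b], which covers [[0, X1]], where the quotient is not
     controlled. *)
  set (b := Rmax r X1 + 1 + C / k).
  assert (HCk : 0 <= C / k) by (apply Rdiv_le_0_compat; lra).
  pose proof (Rmax_l r X1). pose proof (Rmax_r r X1).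
  exists b. split; [unfold b; lra|]. split; [unfold b; lra|].
  intros x Hx. destruct (Rle_lt_dec x X1) as [Hs|Hs].
  - apply Rle_trans with C; [apply HCb; lra|].
    apply Rle_trans with (k * (C / k)); [right; field; lra|].
    apply Rmult_le_compat_l; [lra|unfold b; lra].
  - assert (f x / x < k) by (apply HX; lra).
    apply Rle_trans with (k * x); [|apply Rmult_le_compat_l; lra].
    apply Rlt_le, Rlt_div_l; lra.
Qed.

Theorem corollary4p5 (T eta alpha beta : R) (f a : R -> R)
    (theta1 rho2 M2 alpha1 beta2 : R)
    (Heta : 0 < eta < T)
    (Halpha : 0 < alpha < 2 * T / eta ^ 2)
    (Hbeta : 0 <= beta < (2 * T - alpha * eta ^ 2)
                         / (alpha * eta ^ 2 - 2 * eta + 2 * T))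
    (Hf_cont : continuous_on (fun x => 0 <= x) f)
    (Hf_nonneg : forall x, 0 <= x -> 0 <= f x)
    (Ha_cont : C_seg T a)
    (Ha_nonneg : forall t, 0 <= t <= T -> 0 <= a t)
    (Ha_pos : exists t0, eta <= t0 <= T /\ 0 < a t0)
    (Htheta1 : 0 < theta1 <= 1)
    (Hrho2 : 0 < rho2)
    (HM2 : Lambda2 T eta alpha beta a <= M2)
    (Hi : forall x, gamma T eta alpha beta * rho2 <= x <= rho2 ->
            M2 * rho2 <= f x)
    (Hii_lim : filterlim (fun x => f x / x) (at_right 0) (locally alpha1))
    (Hii_bnd : 0 <= alpha1 < theta1 * Lambda1 T eta alpha beta a)
    (Hiii_lim : is_lim (fun x => f x / x) p_infty beta2)
    (Hiii_bnd : 0 <= beta2 < theta1 * Lambda1 T eta alpha beta a) :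
  exists u1 u2 : R -> R,
    positive_solution T eta alpha beta a f u1 /\
    positive_solution T eta alpha beta a f u2 /\
    0 < sup_norm T u1 /\ sup_norm T u1 < rho2 /\ rho2 < sup_norm T u2.
Proof.
  assert (He2 : 0 < eta ^ 2) by nra.
  assert (Hae : alpha * eta ^ 2 < 2 * T) by (apply Rlt_div_r; lra).
  assert (Hden : 0 < alpha * eta ^ 2 - 2 * eta + 2 * T) by nra.
  assert (HD : 0 < bdet T eta alpha beta).
  { destruct Hbeta as [_ Hb]. apply Rlt_div_r in Hb; [|exact Hden]. unfold bdet. lra. }
  (* The data are constrained only on [[0, T]] and [[0, oo)]. Composing with retractions gives total
     continuous functions, and the constants and solutions depend only on the constrained values. *)
  set (fe := fun x => f (Rmax 0 x)). set (ae := fun t => a (clamp T t)).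
  assert (Ef : forall x, 0 <= x -> f x = fe x).
  { intros x Hx. unfold fe. now rewrite Rmax_right. }
  assert (Ea : forall t, 0 <= t <= T -> a t = ae t).
  { intros t Ht. unfold ae. now rewrite clamp_id. }
  assert (Hfe : forall x, continuous fe x).
  { apply (continuous_on_comp (fun x => 0 <= x) f (Rmax 0)); [exact Hf_cont|intros; apply Rmax_l|apply Rmax_continuous]. }
  assert (Hfe0 : forall x, 0 <= fe x) by (intros; apply Hf_nonneg, Rmax_l).
  assert (Hae' : forall t, continuous ae t).
  { apply (continuous_on_comp (fun t => 0 <= t <= T) a (clamp T)); [exact Ha_cont|intros; apply clamp_in; lra|].
    apply (lip1_continuous 1). intros s t. rewrite Rmult_1_l. apply clamp_close. }
  assert (Hae0 : forall t, 0 <= ae t) by (intros; apply Ha_nonneg, clamp_in; lra).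
  assert (E1 : Lambda1 T eta alpha beta a = Lambda1 T eta alpha beta ae).
  { unfold Lambda1. do 2 f_equal. apply RInt_ext. intros x.
    rewrite Rmin_left, Rmax_right by lra. intros Hx. now rewrite Ea by lra. }
  assert (E2 : Lambda2 T eta alpha beta a = Lambda2 T eta alpha beta ae).
  { unfold Lambda2. do 2 f_equal. apply RInt_ext. intros x.
    rewrite Rmin_left, Rmax_right by lra. intros Hx. now rewrite Ea by lra. }
  rewrite E1 in *. rewrite E2 in HM2.
  assert (Hw : 0 < weight T eta ae).
  { apply weighted_integral_pos; auto; [lra|]. destruct Ha_pos as [t0 [Ht0 Hp]].
    exists t0. rewrite <- Ea by lra. auto. }
  pose proof (gamma_bounds T eta alpha beta Heta (proj1 Halpha) (proj1 Hbeta) HD) as Hg.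
  assert (Hife : forall x, gamma T eta alpha beta * rho2 <= x <= rho2 -> M2 * rho2 <= fe x).
  { intros x Hx. rewrite <- Ef by nra. now apply Hi. }
  pose proof (lambda1_pos T eta alpha beta Heta (proj1 Halpha) (proj1 Hbeta) HD ae Hae' Hae0 Hw) as HL.
  set (Lam := Lambda1 T eta alpha beta ae) in *.
  assert (HLt : theta1 * Lam <= Lam) by nra.
  (* [q] is the midpoint of [l / Lam] and 1: one half of the gap makes the linear bounds on [f]
     available, the other makes the compression strict. *)
  assert (Hslope : forall l, 0 <= l < theta1 * Lam -> exists q, 0 < q < 1 /\ l < Lam * q).
  { intros l Hl. exists ((l / Lam + 1) / 2).
    assert (0 <= l / Lam) by (apply Rdiv_le_0_compat; lra).
    assert (l / Lam < 1) by (apply Rlt_div_l; lra).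
    split; [lra|]. replace (Lam * ((l / Lam + 1) / 2)) with ((l + Lam) / 2) by (field; lra). lra. }
  destruct (Hslope alpha1 Hii_bnd) as [q1 [Hq1 Hl1]].
  destruct (Hslope beta2 Hiii_bnd) as [q2 [Hq2 Hl2]].
  destruct (linear_bound_at_0 fe (Lam * q1) alpha1 rho2) as [r1 [Hr1 Hb1]]; auto; [nra| |].
  { apply filterlim_ext_loc with (2 := Hii_lim). exists (mkposreal 1 Rlt_0_1).
    intros y _ Hy. rewrite Ef by lra. reflexivity. }
  destruct (linear_bound_at_infinity fe (Lam * q2) beta2 rho2) as [b [Hb [Hb0 Hb2]]]; auto; [nra| |].
  { apply is_lim_ext_loc with (2 := Hiii_lim). exists 0. intros y Hy. rewrite Ef by lra. reflexivity. }
  destruct (fixed_point_below T eta alpha beta Heta (proj1 Halpha) (proj1 Hbeta) Hae HD ae fe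
              Hae' Hae0 Hfe Hfe0 Hw rho2 M2 q1 r1) as (w1 & t1 & Hc1 & Hf1 & Ht1 & Hm1 & Hn1); auto; [lra| |].
  { intros x Hx. rewrite <- Rmult_assoc. now apply Hb1. }
  destruct (fixed_point_above T eta alpha beta Heta (proj1 Halpha) (proj1 Hbeta) Hae HD ae fe
              Hae' Hae0 Hfe Hfe0 Hw rho2 M2 q2 b) as (w2 & t2 & Hc2 & Hf2 & Ht2 & Hm2 & Hn2); auto; [lra| |].
  { intros x Hx. rewrite <- Rmult_assoc. now apply Hb2. }
  destruct (fixed_point_solution T eta alpha beta ae fe a f w1 t1) as [u1 [S1 N1]]; auto; [lra|lra|lra|].
  destruct (fixed_point_solution T eta alpha beta ae fe a f w2 t2) as [u2 [S2 N2]]; auto; [lra|lra|lra|].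
  exists u1, u2. rewrite N1, N2.
  split; [exact S1|]. split; [exact S2|]. lra.
Qed.
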